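(* Let $N\ge 1$ be an integer, let $z\in\mathbb R^{N\times N}$, let $f\colon\mathbb R^{N\times N}\to\,]-\infty,+\infty]$ be proper, lower semicontinuous and convex, let $\mu\in\,]0,+\infty[$, let $p\in[1,+\infty]$ with conjugate index $p^*$, and set $$D_p=\Big\{\big(\nu^{(1)}_{k,l},\nu^{(2)}_{k,l}\big)_{1\le k,l\le N}\in\mathbb R^{N\times N}\oplus\mathbb R^{N\times N}\;:\;\max_{1\le k,l\le N}\big|(\nu^{(1)}_{k,l},\nu^{(2)}_{k,l})\big|_{p^*}\le 1\Big\}.$$ Consider the primal problem $$\underset{x\in\mathbb R^{N\times N}}{\text{minimize}}\;\;f(x)+\mu\operatorname{tv}_p(x)+\tfrac12\|x-z\|^2\qquad (P)$$ and the dual problem $$\underset{v\in D_p}{\text{minimize}}\;\;\widetilde{f^*}(z+\mu\operatorname{div}v).\qquad (D)$$ Let $\big((\alpha^{(1)}_{n,k,l})_{1\le k,l\le N}\big)_{n\in\mathbb N}$ and $\big((\alpha^{(2)}_{n,k,l})_{1\le k,l\le N}\big)_{n\in\mathbb N}$ be sequences in $\mathbb R^{N\times N}$ such that $$\sum_{n\in\mathbb N}\sqrt{\sum_{1\le k,l\le N}|\alpha^{(1)}_{n,k,l}|^2+|\alpha^{(2)}_{n,k,l}|^2}<+\infty,$$ and let $(b_n)_{n\in\mathbb N}$ be a sequence in $\mathbb R^{N\times N}$ such that $\sum_{n\in\mathbb N}\|b_n\|<+\infty$. Let $\varepsilon\in\,]0,\min\{1,\mu^{-1}/8\}[$, let $v_0=(\nu^{(1)}_{0,k,l},\nu^{(2)}_{0,k,l})_{1\le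 k,l\le N}\in\mathbb R^{N\times N}\oplus\mathbb R^{N\times N}$, let $(\tau_n)_{n\in\mathbb N}$ be a sequence in $[\varepsilon,\mu^{-1}/4-\varepsilon]$, let $(\lambda_n)_{n\in\mathbb N}$ be a sequence in $[\varepsilon,1]$, and define, for every $n\in\mathbb N$, $$x_n=\operatorname{prox}_f(z+\mu\operatorname{div}v_n)+b_n,\qquad \big(\zeta^{(1)}_{n,k,l},\zeta^{(2)}_{n,k,l}\big)_{1\le k,l\le N}=v_n+\tau_n\nabla x_n,$$ and, for every $(k,l)\in\{1,\dots,N\}^2$ and $i\in\{1,2\}$, $$\nu^{(i)}_{n+1,k,l}=\nu^{(i)}_{n,k,l}+\lambda_n\Big(\pi^{(i)}_p\big(\zeta^{(1)}_{n,k,l},\zeta^{(2)}_{n,k,l}\big)+\alpha^{(i)}_{n,k,l}-\nu^{(i)}_{n,k,l}\Big),$$ with $v_{n+1}=(\nu^{(1)}_{n+1,k,l},\nu^{(2)}_{n+1,k,l})_{1\le k,l\le N}$. Then $(v_n)_{n\in\mathbb N}$ converges to a solution $v$ to $(D)$, the point $x=\operatorname{prox}_f(z+\mu\operatorname{div}v)$ is the (unique) solution to $(P)$, and $x_n\to x$.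
   Context: $\mathbb R^{N\times N}$ and $\mathbb R^{N\times N}\oplus\mathbb R^{N\times N}$ carry their standard Euclidean (Frobenius) norms $\|\cdot\|$. The conjugate index is $p^*=+\infty$ if $p=1$, $p^*=1$ if $p=+\infty$, and $p^*=p/(p-1)$ otherwise. For $(\eta^{(1)},\eta^{(2)})\in\mathbb R^2$, $|(\eta^{(1)},\eta^{(2)})|_p=(|\eta^{(1)}|^p+|\eta^{(2)}|^p)^{1/p}$ if $p<+\infty$ and $\max\{|\eta^{(1)}|,|\eta^{(2)}|\}$ if $p=+\infty$. For $\mathsf y\in\mathbb R^2$, $(\pi^{(1)}_p\mathsf y,\pi^{(2)}_p\mathsf y)$ is the Euclidean projection of $\mathsf y$ onto the closed unit $\ell^{p^*}$ ball $\{\mathsf u\in\mathbb R^2:|\mathsf u|_{p^*}\le1\}$. Discrete gradient: $\nabla\colon\mathbb R^{N\times N}\to\mathbb R^{N\times N}\oplus\mathbb R^{N\times N}$ maps $(\xi_{k,l})$ to $(\eta^{(1)}_{k,l},\eta^{(2)}_{k,l})$ with $\eta^{(1)}_{k,l}=\xi_{k+1,l}-\xi_{k,l}$ if $k<N$, $\eta^{(1)}_{N,l}=0$, $\eta^{(2)}_{k,l}=\xi_{k,l+1}-\xi_{k,l}$ if $l<N$, $\eta^{(2)}_{k,N}=0$. Discrete divergence: $\operatorname{div}\colon\mathbb R^{N\times N}\oplus\mathbb R^{N\times N}\to\mathbb R^{N\times N}$ maps $(\eta^{(1)}_{k,l},\eta^{(2)}_{k,l})$ to $(\xi^{(1)}_{k,l}+\xi^{(2)}_{k,l})$,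 where $\xi^{(1)}_{k,l}$ equals $\eta^{(1)}_{1,l}$ if $k=1$, $\eta^{(1)}_{k,l}-\eta^{(1)}_{k-1,l}$ if $1<k<N$, $-\eta^{(1)}_{N-1,l}$ if $k=N$; and $\xi^{(2)}_{k,l}$ equals $\eta^{(2)}_{k,1}$ if $l=1$, $\eta^{(2)}_{k,l}-\eta^{(2)}_{k,l-1}$ if $1<l<N$, $-\eta^{(2)}_{k,N-1}$ if $l=N$. (One has $\operatorname{div}=-\nabla^*$; for $N=1$ both operators are zero.) Discrete total variation of order $p$: $\operatorname{tv}_p(x)=\sum_{1\le k,l\le N}|(\eta^{(1)}_{k,l},\eta^{(2)}_{k,l})|_p$, where $(\eta^{(1)}_{k,l},\eta^{(2)}_{k,l})_{1\le k,l\le N}=\nabla x$. For $\varphi$ proper, lower semicontinuous and convex: $\varphi^*(u)=\sup_x\langle x\mid u\rangle-\varphi(x)$; $\widetilde{\varphi}(x)=\min_y\varphi(y)+\frac12\|x-y\|^2$ is the Moreau envelope (so $\widetilde{f^*}$ is the Moreau envelope of $f^*$); $\operatorname{prox}_\varphi x$ is the unique minimizer of $y\mapsto\varphi(y)+\frac12\|x-y\|^2$. *)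

(* Defs.v *)
From HB Require Import structures.
From mathcomp Require Import all_boot all_order all_algebra.
From mathcomp Require Import all_classical all_reals all_analysis.

Set Implicit Arguments.
Unset Strict Implicit.
Unset Printing Implicit Defensive.

Import Order.TTheory GRing.Theory Num.Theory.
Import numFieldNormedType.Exports.

Local Open Scope classical_set_scope.
Local Open Scope ring_scope.

Definition minimizer {T : Type} {d : Order.disp_t} {U : porderType d}
    (C : set T) (g : T -> U) (x : T) : Prop :=
  C x /\ forall y, C y -> (g x <= g y)%O.

(* The library norm on matrices and on products is the max norm, so the
   Euclidean norms and inner product are introduced separately; the topologies
   coincide, and limits and semicontinuity refer to the library topology. *)
Section Euclidean.
Context {R : realType} {N : nat}.
Implicit Types (x y : 'M[R]_N) (v : 'M[R]_N * 'M[R]_N) (a : R * R).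

Definition frob_dot x y : R := \sum_(k < N) \sum_(l < N) x k l * y k l.

Definition frob_norm x : R :=
  Num.sqrt (\sum_(k < N) \sum_(l < N) `|x k l| ^+ 2).

Definition frob_norm2 v : R :=
  Num.sqrt (\sum_(k < N) \sum_(l < N) (`|v.1 k l| ^+ 2 + `|v.2 k l| ^+ 2)).

Definition eucl_norm a : R := Num.sqrt (`|a.1| ^+ 2 + `|a.2| ^+ 2).

End Euclidean.

Section ConvexAnalysis.
Context {R : realType} {N : nat}.
Implicit Types (phi : 'M[R]_N -> \bar R) (x u : 'M[R]_N).
Local Open Scope ereal_scope.

Definition proper_fun phi : Prop :=
  (forall x, -oo < phi x) /\ (exists x, phi x < +oo).

(* Weights lie in ]0, 1[, so no product 0 * +oo occurs. *)
Definition convex_efun phi : Prop :=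
  forall x y (t : R), (0 < t < 1)%R ->
    phi (t *: x + (1 - t) *: y)%R <= t%:E * phi x + (1 - t)%:E * phi y.

Definition fenchel_conj phi u : \bar R :=
  ereal_sup [set (frob_dot x u)%:E - phi x | x in setT].

Definition prox_objective phi x (y : 'M[R]_N) : \bar R :=
  phi y + (2^-1 * frob_norm (x - y) ^+ 2)%:E.

Definition moreau_env phi x : \bar R :=
  ereal_inf [set prox_objective phi x y | y in setT].

Definition prox phi x : 'M[R]_N :=
  get (minimizer setT (prox_objective phi x)).

End ConvexAnalysis.

Section TotalVariation.
Context {R : realType} {N : nat}.
Implicit Types (x : 'M[R]_N) (v : 'M[R]_N * 'M[R]_N) (p q : \bar R).

(* The l^p norm on R^2, meaningful for 1 <= p <= +oo. *)
Definition lp_norm p (a : R * R) : R :=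
  match p with
  | r%:E => (`|a.1| `^ r + `|a.2| `^ r) `^ r^-1
  | +oo%E => Num.max `|a.1| `|a.2|
  | -oo%E => 0
  end.

Definition lp_ball p : set (R * R) := [set u | lp_norm p u <= 1].

Definition lp_proj q (y : R * R) : R * R :=
  get (minimizer (lp_ball q) (fun u => eucl_norm (y - u))).

(* (pi_p^(1) y, pi_p^(2) y): the projection is onto the ball of the conjugate
   index. The conjugates of 1 and +oo are +oo and 1. *)
Definition pi_ p (y : R * R) : R * R := lp_proj (hoelder_conjugate p) y.

(* Rows and columns are numbered from 0, so the last index is N.-1. The cyclic
   ordS and ord_pred are used only where they do not wrap around. *)
Definition grad x : 'M[R]_N * 'M[R]_N :=
  (\matrix_(k < N, l < N) (if (k.+1 < N)%N then x (ordS k) l - x k l else 0),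
   \matrix_(k < N, l < N) (if (l.+1 < N)%N then x k (ordS l) - x k l else 0)).

(* For N = 1 the first and last index coincide and the divergence is 0. *)
Definition div1 (eta : 'M[R]_N) (k l : 'I_N) : R :=
  if N == 1%N then 0
  else if k == 0%N :> nat then eta k l
  else if (k.+1 < N)%N then eta k l - eta (ord_pred k) l
  else - eta (ord_pred k) l.

Definition div2 (eta : 'M[R]_N) (k l : 'I_N) : R :=
  if N == 1%N then 0
  else if l == 0%N :> nat then eta k l
  else if (l.+1 < N)%N then eta k l - eta k (ord_pred l)
  else - eta k (ord_pred l).

Definition div v : 'M[R]_N :=
  \matrix_(k < N, l < N) (div1 v.1 k l + div2 v.2 k l).

Definition tv p x : R :=
  \sum_(k < N) \sum_(l < N) lp_norm p ((grad x).1 k l, (grad x).2 k l).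

(* The default value 0 of the maximum is harmless, norms being nonnegative. *)
Definition dual_ball p : set ('M[R]_N * 'M[R]_N) :=
  [set v : 'M[R]_N * 'M[R]_N |
    \big[Num.max/0]_(k < N) \big[Num.max/0]_(l < N)
      lp_norm (hoelder_conjugate p) (v.1 k l, v.2 k l) <= 1].

Definition primal_objective (f : 'M[R]_N -> \bar R) (mu : R) p
    (z x : 'M[R]_N) : \bar R :=
  (f x + (mu * tv p x)%:E + (2^-1 * frob_norm (x - z) ^+ 2)%:E)%E.

Definition dual_objective (f : 'M[R]_N -> \bar R) (mu : R)
    (z : 'M[R]_N) v : \bar R :=
  moreau_env (fenchel_conj f) (z + mu *: div v).

End TotalVariation.

(* Main.v *)
Require Import Defs.
From HB Require Import structures.
From mathcomp Require Import all_boot all_order all_algebra.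
From mathcomp Require Import all_classical all_reals all_analysis.
From mathcomp Require Import ring lra.

(* With F v := prox f (z + mu div v), the dual objective has gradient
   - mu grad (F v), because the Moreau envelope of f^* has gradient prox f. Hence
   v solves (D) iff it solves the variational inequality
   <u - v, grad (F v)> <= 0 on D_p, and the algorithm is an inexact projected
   gradient iteration with step tau_n / mu. Firm nonexpansiveness of prox f and
   |grad|^2 <= 8 make the exact step quasi-nonexpansive towards every solution v,
   with a gain controlling |F v_n - F v| and the residual. The errors being
   summable, |v_n - v| therefore converges, F v_n -> F v, and the residual
   vanishes; so any cluster point of v_n is a solution, and the whole sequence
   converges to it. On the primal side, the variational inequality and the
   l^p - l^p* duality give <v, grad (F v)> = tv_p (F v), from which F v
   minimizes the strongly convex objective of (P). *)

Import Order.TTheory GRing.Theory Num.Theory.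
Import numFieldNormedType.Exports.

Set Implicit Arguments.
Unset Strict Implicit.
Unset Printing Implicit Defensive.

Local Open Scope classical_set_scope.
Local Open Scope ring_scope.

(** * Inner products *)

(** The form is an explicit argument because the norm carried by matrices and pairs is the max norm.
    One theory then serves both the Frobenius product and its analogue on pairs. *)
Record inner_product {R : realType} {V : lmodType R} (d : V -> V -> R) : Prop :=
  InnerProduct {
    ipC : forall x y, d x y = d y x;
    ipDl : forall x y z, d (x + y) z = d x z + d y z;
    ipZl : forall a x y, d (a *: x) y = a * d x y;
    ip_ge0 : forall x, 0 <= d x x }.

Definition ipnorm {R : realType} {V : lmodType R} (d : V -> V -> R) (x : V) : R :=
  Num.sqrt (d x x).

Section InnerProductTheory.
Context {R : realType} {V : lmodType R} {d : V -> V -> R}.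
Hypothesis hd : inner_product d.
Implicit Types x y : V.
Local Notation "`[ x ]" := (ipnorm d x).

Lemma ipDr x y z : d x (y + z) = d x y + d x z.
Proof. by rewrite (ipC hd) (ipDl hd) !(ipC hd _ x). Qed.

Lemma ipZr a x y : d x (a *: y) = a * d x y.
Proof. by rewrite (ipC hd) (ipZl hd) (ipC hd). Qed.

Lemma ipNl x y : d (- x) y = - d x y.
Proof. by rewrite -scaleN1r (ipZl hd) mulN1r. Qed.

Lemma ipNr x y : d x (- y) = - d x y.
Proof. by rewrite -scaleN1r ipZr mulN1r. Qed.

Definition ipE := (ipDl hd, ipDr, ipNl, ipNr, ipZl hd, ipZr).

Lemma ipnorm_ge0 x : 0 <= `[x].
Proof. exact: sqrtr_ge0. Qed.

Lemma ipnorm_sqr x : `[x] ^+ 2 = d x x.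
Proof. by rewrite sqr_sqrtr// (ip_ge0 hd). Qed.

Lemma ipnormN x : `[- x] = `[x].
Proof. by rewrite /ipnorm !ipE opprK. Qed.

Lemma ipnormBC x y : `[x - y] = `[y - x].
Proof. by rewrite -ipnormN opprB. Qed.

Lemma ipnormZ a x : `[a *: x] = `|a| * `[x].
Proof. by rewrite /ipnorm !ipE mulrA -expr2 sqrtrM ?sqr_ge0// sqrtr_sqr. Qed.

(** Cauchy-Schwarz, from the nonnegativity of the polynomial $t\mapsto d(x+ty,x+ty)$. *)
Lemma ip_sqr_le x y : d x y ^+ 2 <= d x x * d y y.
Proof.
have H t : 0 <= d x x + 2 * t * d x y + t ^+ 2 * d y y.
  have := ip_ge0 hd (x + t *: y); rewrite !ipE (ipC hd y x).
  by congr (_ <= _); ring.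
have [y0|yN0] := eqVneq (d y y) 0.
  have [->|xyN0] := eqVneq (d x y) 0.
    by rewrite expr0n/= mulr_ge0// (ip_ge0 hd).
  (* Here the polynomial is affine in [t] with nonzero slope, and this [t] would give it the value
     $-1$. *)
  have := H (- (d x x + 1) / (2 * d x y)); rewrite y0 mulr0 addr0.
  suff -> : d x x + 2 * (- (d x x + 1) / (2 * d x y)) * d x y = -1.
    by rewrite ler0N1.
  by field.
have y_gt0 : 0 < d y y by rewrite lt_neqAle eq_sym yN0 (ip_ge0 hd).
(* The vertex of the parabola. *)
have := H (- d x y / d y y).
have -> : d x x + 2 * (- d x y / d y y) * d x y + (- d x y / d y y) ^+ 2 * d y y
  = d x x - d x y ^+ 2 / d y y by field.
by rewrite subr_ge0 ler_pdivrMr.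
Qed.

Lemma ip_le_norm x y : d x y <= `[x] * `[y].
Proof.
apply: le_trans (ler_norm _) _.
by rewrite -sqrtr_sqr -sqrtrM ?(ip_ge0 hd)// ler_wsqrtr// ip_sqr_le.
Qed.

Lemma ipnormD x y : `[x + y] <= `[x] + `[y].
Proof.
rewrite -(ler_pXn2r (n := 2))// ?nnegrE ?addr_ge0 ?ipnorm_ge0//.
rewrite ipnorm_sqr sqrrD !ipnorm_sqr !ipE (ipC hd y x).
have := ip_le_norm x y; lra.
Qed.

Lemma ipnormD_ge x y : `[x] - `[y] <= `[x + y].
Proof. by rewrite lerBlDr -(ipnormN y) -{1}(addrK y x) ipnormD. Qed.

Lemma ipnormB_trans y x z : `[x - z] <= `[x - y] + `[y - z].
Proof. by rewrite -[x - z](subrKA y) ipnormD. Qed.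

Lemma ip_sqrD x y : d (x + y) (x + y) = d x x + 2 * d x y + d y y.
Proof. by rewrite !ipE (ipC hd y x); ring. Qed.

Lemma ip_sqrB x y : d (x - y) (x - y) = d x x - 2 * d x y + d y y.
Proof. by rewrite !ipE (ipC hd y x); ring. Qed.

Lemma ip_sqr_convex (t : R) x y : 0 <= t <= 1 ->
  d ((1 - t) *: x + t *: y) ((1 - t) *: x + t *: y) <=
  (1 - t) * d x x + t * d y y.
Proof.
move=> /andP[t0 t1]; rewrite -subr_ge0.
have -> : (1 - t) * d x x + t * d y y -
    d ((1 - t) *: x + t *: y) ((1 - t) *: x + t *: y) =
    t * (1 - t) * d (x - y) (x - y).
  by rewrite !ipE (ipC hd y x); ring.
by rewrite !mulr_ge0 ?subr_ge0// (ip_ge0 hd).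
Qed.

(** The hypotheses are the variational inequalities of two projections, each tested at the other
    projected point. Their sum says that the cross term in the expansion of $\|a-b\|^2$ is
    nonnegative. *)
Lemma proj_firm (a b pa pb : V) :
  d (pb - pa) (a - pa) <= 0 -> d (pa - pb) (b - pb) <= 0 ->
  d (pa - pb) (pa - pb) + d ((a - pa) - (b - pb)) ((a - pa) - (b - pb)) <=
  d (a - b) (a - b).
Proof.
move=> H1 H2.
have E : a - b = (pa - pb) + ((a - pa) - (b - pb)).
  by rewrite addrACA -!opprD !subrKC.
rewrite [in leRHS]E (ip_sqrD (pa - pb)).
set w := a - pa - (b - pb).
have -> : d (pa - pb) w = - d (pb - pa) (a - pa) - d (pa - pb) (b - pb).
  by rewrite -(opprB pa pb) ipNl opprK -ipNr -ipDr.
lra.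
Qed.

End InnerProductTheory.

(** * Limits of real sequences *)

Section RealLimits.
Context {R : realType}.
Implicit Types (r e s : R^nat).

(** Subtracting the partial sums of [e] makes [r] nonincreasing, and bounded below by minus the sum
    of [e]. *)
Lemma quasi_monotone_cvg r e : (forall n, 0 <= r n) ->
  (forall n, 0 <= e n) -> (forall n, r n.+1 <= r n + e n) ->
  cvgn (series e) -> cvgn r.
Proof.
move=> r0 e0 rS ecvg.
have -> : r = (r \- series e) \+ series e.
  by apply/funext => n /=; rewrite subrK.
apply: is_cvgD => //; apply: nonincreasing_is_cvgn.
  apply/nonincreasing_seqP => n; rewrite /= /series/= big_nat_recr//=.
  by have := rS n; lra.
exists (- limn (series e)) => _ [n _ <-] /=.
rewrite lerBrDl; apply: le_trans (r0 n).
by rewrite subr_le0; apply: nondecreasing_cvgn_le => //; exact: nondecreasing_series.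
Qed.

Lemma squeeze0 r s : (forall n, 0 <= r n <= s n) ->
  s @ \oo --> 0 -> r @ \oo --> 0.
Proof.
move=> H s0; apply: (@squeeze_cvgr _ _ _ _ (fun=> 0) s) => //.
  exact: nearW.
exact: cvg_cst.
Qed.

Lemma sqr_cvg0 r : (fun n => r n ^+ 2) @ \oo --> 0 -> (forall n, 0 <= r n) ->
  r @ \oo --> 0.
Proof.
move=> H r0; have -> : r = Num.sqrt \o (fun n => r n ^+ 2).
  by apply/funext => n /=; rewrite sqrtr_sqr ger0_norm.
rewrite -[X in _ --> X]sqrtr0.
by apply: continuous_cvg => //; exact: sqrt_continuous.
Qed.

(** The limit $t\to0$, by which first-order conditions are extracted from inequalities along
    segments. *)
Lemma le0_of_small (a b : R) : (forall t, 0 < t < 1 -> a <= t * b) -> a <= 0.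
Proof.
move=> H; rewrite leNgt; apply/negP => a0.
have b0 : 0 < b.
  have := H 2^-1; rewrite invr_gt0 ltr0n invf_lt1 ?ltr1n// => /(_ isT); lra.
have t0 : 0 < a / (2 * (a + b)) by rewrite divr_gt0// mulr_gt0// addr_gt0.
have t1 : a / (2 * (a + b)) < 1.
  by rewrite ltr_pdivrMr ?mulr_gt0 ?addr_gt0//; lra.
(* For this [t] one has $tb=\frac a2\cdot\frac b{a+b}<a$. *)
have := H (a / (2 * (a + b))); rewrite t0 t1 => /(_ isT).
rewrite mulrAC ler_pdivlMr ?mulr_gt0 ?addr_gt0//; nra.
Qed.

End RealLimits.

(** * Inexact projected gradient iteration *)

Section ForwardBackward.
Context {R : realType} {V W : lmodType R}.
Context {dV : V -> V -> R} {dW : W -> W -> R}.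
Hypotheses (hV : inner_product dV) (hW : inner_product dW).
Context {G : W -> V} {L : V -> W}.
Hypothesis GB : forall x y, G (x - y) = G x - G y.
Hypothesis LB : forall x y, L (x - y) = L x - L y.
Hypothesis adj : forall v x, dW (L v) x = - dV v (G x).
Hypothesis G_bound : forall x, dV (G x) (G x) <= 8 * dW x x.

Local Notation "`[ x ]V" := (ipnorm dV x) (format "`[ x ]V").
Local Notation "`[ x ]W" := (ipnorm dW x) (format "`[ x ]W").

(** The 3 is a convenient bound for $\sqrt8$; the sharp 8 is kept for the step-size estimate. *)
Lemma G_norm_le x : `[G x]V <= 3 * `[x]W.
Proof.
rewrite -(ler_pXn2r (n := 2))// ?nnegrE ?mulr_ge0 ?ipnorm_ge0//.
rewrite exprMn !(ipnorm_sqr hV) !(ipnorm_sqr hW).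
have := G_bound x; have := ip_ge0 hW x; lra.
Qed.

(** The adjoint inherits the bound: $\|Lv\|^2=-\langle v,G(Lv)\rangle\le3\|v\|\,\|Lv\|$. *)
Lemma L_norm_le v : `[L v]W <= 3 * `[v]V.
Proof.
have [->|Lv0] := eqVneq `[L v]W 0; first by rewrite mulr_ge0 ?ipnorm_ge0.
have Lv_gt0 : 0 < `[L v]W by rewrite lt_neqAle eq_sym Lv0 ipnorm_ge0.
rewrite -(ler_pM2r Lv_gt0) -expr2 (ipnorm_sqr hW) adj -(ipNl hV).
apply: le_trans (ip_le_norm hV _ _) _; rewrite (ipnormN hV) (mulrAC 3) mulrC.
by rewrite ler_wpM2r ?ipnorm_ge0// G_norm_le.
Qed.

Context {mu : R} {z : W} {T : W -> W} {C : set V} {P : V -> V}.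
Hypothesis mu_gt0 : 0 < mu.
Hypothesis T_firm : forall a b, dW (T a - T b) (T a - T b) <= dW (T a - T b) (a - b).
Hypothesis P_proj : forall y, C (P y) /\ forall u, C u -> dV (u - P y) (y - P y) <= 0.

Let F v := T (z + mu *: L v).

Definition VI_solution v := C v /\ forall u, C u -> dV (u - v) (G (F v)) <= 0.

Lemma T_nonexpansive a b : `[T a - T b]W <= `[a - b]W.
Proof.
have [->|N0] := eqVneq `[T a - T b]W 0; first exact: ipnorm_ge0.
have gt0 : 0 < `[T a - T b]W by rewrite lt_neqAle eq_sym N0 ipnorm_ge0.
rewrite -(ler_pM2r gt0) -expr2 (ipnorm_sqr hW) mulrC.
exact: le_trans (T_firm a b) (ip_le_norm hW _ _).
Qed.

Lemma P_nonexpansive a b : `[P a - P b]V <= `[a - b]V.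
Proof.
have [Ca Pa] := P_proj a; have [Cb Pb] := P_proj b.
rewrite ler_wsqrtr//; have := proj_firm hV (Pa _ Cb) (Pb _ Ca).
have := ip_ge0 hV (a - P a - (b - P b)); lra.
Qed.

Lemma F_lipschitz v w : `[F v - F w]W <= 3 * mu * `[v - w]V.
Proof.
apply: le_trans (T_nonexpansive _ _) _.
rewrite opprD addrACA subrr add0r -scalerBr -LB (ipnormZ hW) gtr0_norm//.
by rewrite -mulrA mulrCA ler_wpM2l ?L_norm_le// ltW.
Qed.

(** Minty's device: the inequality with [F] evaluated along the segment passes to its endpoint [v]
    by continuity of [F]. *)
Lemma VI_of_segment v u :
  (forall t, 0 < t < 1 -> dV (u - v) (G (F (v + t *: (u - v)))) <= 0) ->
  dV (u - v) (G (F v)) <= 0.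
Proof.
(* The factor $9\mu$ is the bound 3 for [G] times the Lipschitz constant $3\mu$ of [F]; the points
   are $t\|u-v\|$ apart. *)
move=> H; apply: (@le0_of_small _ _ (9 * mu * `[u - v]V ^+ 2)) => t t01.
have := H t t01; have /andP[t0 _] := t01; set vt := v + _ => Ht.
have -> : dV (u - v) (G (F v)) = dV (u - v) (G (F vt)) + dV (u - v) (G (F v - F vt)).
  by rewrite GB (ipDr hV) (ipNr hV) [RHS]addrC subrK.
apply: le_trans (_ : dV (u - v) (G (F v - F vt)) <= _); first by rewrite gerDr.
apply: le_trans (ip_le_norm hV _ _) _.
have H2 := G_norm_le (F v - F vt); have H3 := F_lipschitz v vt.
rewrite (_ : v - vt = - (t *: (u - v))) in H3; last first.
  by rewrite /vt opprD addrA subrr add0r.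
rewrite (ipnormN hV) (ipnormZ hV) gtr0_norm// in H3.
have n0 := ipnorm_ge0 (d := dV) (u - v).
apply: le_trans (ler_wpM2l n0 H2) _.
have := ler_wpM2l n0 H3; lra.
Qed.

(* Cocoercivity of v |-> - G (F v): firm nonexpansiveness of T and
   |G|^2 <= 8 absorb the quadratic term for steps below mu^-1 / 4. *)
Lemma forward_backward_step (t : R) v w y : 0 <= t ->
  VI_solution w -> y = P (v + t *: G (F v)) ->
  dV (y - w) (y - w) + dV ((v - y) + t *: G (F v - F w)) ((v - y) + t *: G (F v - F w))
  + 8 * t * (mu^-1 / 4 - t) * dW (F v - F w) (F v - F w) <= dV (v - w) (v - w).
Proof.
move=> t0 [Cw VIw] yE.
have [Cy Py] := P_proj (v + t *: G (F v)); rewrite -yE in Cy Py.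
(* The variational inequality makes [w] a fixed point: it plays the role of the projection of
   $w+tG(Fw)$ in [proj_firm]. *)
have Hw : dV (y - w) (w + t *: G (F w) - w) <= 0.
  by rewrite [w + _ - w]addrC addKr (ipZr hV) mulr_ge0_le0// VIw.
have := proj_firm hV (Py _ Cw) Hw.
have -> : v + t *: G (F v) - y - (w + t *: G (F w) - w) =
          (v - y) + t *: G (F v - F w).
  by rewrite GB scalerBr [w + _ - w]addrC addKr addrA [v - y + _]addrAC.
have -> : v + t *: G (F v) - (w + t *: G (F w)) =
          (v - w) + t *: G (F v - F w).
  by rewrite GB scalerBr opprD addrACA.
rewrite (ip_sqrD hV (v - w)) !(ipZl hV, ipZr hV).
have Hd : mu * dV (v - w) (G (F v - F w)) <= - dW (F v - F w) (F v - F w).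
  rewrite lerNr -mulrN -adj LB.
  have := T_firm (z + mu *: L v) (z + mu *: L w).
  by rewrite (opprD z) addrACA subrr add0r -scalerBr (ipZr hW) (ipC hW _ (_ - L w)).
have {}Hd : dV (v - w) (G (F v - F w)) <= - (mu^-1 * dW (F v - F w) (F v - F w)).
  by rewrite -mulrN ler_pdivlMl.
have HG := G_bound (F v - F w).
set A := dV (v - w) (v - w); set B := dV _ (G _); set q := dW _ _.
rewrite -/B -/q in Hd; rewrite -/q in HG; set g := dV (G _) _ in HG *.
set y1 := dV (y - w) _; set y2 := dV (v - y + _) _ => H.
(* The expansion contributes $2tB+t^2g\le-2t\mu^{-1}q+8t^2q=-8t(\mu^{-1}/4-t)q$. *)
have h1 : t * B <= t * - (mu^-1 * q) by rewrite ler_wpM2l.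
have h2 : t * (t * g) <= t * (t * (8 * q)) by rewrite !ler_wpM2l.
lra.
Qed.

(** * Quasi-Fejér monotonicity of the perturbed iteration *)

Context {eps : R} {tau lambda : nat -> R} {a : nat -> V} {b : nat -> W}.
Context {v : nat -> V}.
Hypothesis eps_gt0 : 0 < eps.
Hypothesis htau : forall n, eps <= tau n <= mu^-1 / 4 - eps.
Hypothesis hlambda : forall n, eps <= lambda n <= 1.
Hypothesis a_summable : cvgn (series (fun n => `[a n]V)).
Hypothesis b_summable : cvgn (series (fun n => `[b n]W)).
Hypothesis vS : forall n, v n.+1 =
  v n + lambda n *: (P (v n + tau n *: G (F (v n) + b n)) + a n - v n).

Let y n := P (v n + tau n *: G (F (v n))).
(** Bounds the total error of step [n]: $b_n$ passes through $\tau_nG$, whose norm is below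
    $\mu^{-1}$, and then through the nonexpansive [P]. *)
Let e n := mu^-1 * `[b n]W + `[a n]V.

Let e_ge0 n : 0 <= e n.
Proof. by rewrite addr_ge0 ?mulr_ge0 ?ipnorm_ge0 ?invr_ge0// ltW. Qed.

Let e_summable : cvgn (series e).
Proof.
have -> : series e =
  (mu^-1 *: series (fun n => `[b n]W)) + series (fun n => `[a n]V).
  by apply/funext => n; rewrite /series/= big_split/= -mulr_sumr.
by apply: is_cvgD => //; exact: is_cvgZr.
Qed.

Let tau_ge0 n : 0 <= tau n.
Proof. by have /andP[H _] := htau n; apply: le_trans H; exact: ltW. Qed.

Let error_le n :
  `[P (v n + tau n *: G (F (v n) + b n)) - y n + a n]V <= e n.
Proof.
apply: le_trans (ipnormD hV _ _) _; rewrite lerD2r.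
apply: le_trans (P_nonexpansive _ _) _.
rewrite opprD addrACA subrr add0r -scalerBr -GB addrAC subrr add0r.
rewrite -(ler_pXn2r (n := 2))// ?nnegrE ?mulr_ge0 ?ipnorm_ge0 ?invr_ge0 ?(ltW mu_gt0)//.
rewrite exprMn (ipnorm_sqr hV) (ipnorm_sqr hW) !(ipZl hV, ipZr hV) mulrA -expr2.
have /andP[_ htn] := htau n.
have H : tau n ^+ 2 <= (mu^-1 / 4) ^+ 2.
  have t4 : tau n <= mu^-1 / 4 by move: htn eps_gt0; lra.
  by rewrite ler_pXn2r// nnegrE//; apply: le_trans t4.
have bb := ip_ge0 hW (b n).
(* Since $\tau_n\le\mu^{-1}/4$ and $|G|^2\le8$, the squared factor is at most $8/16=1/2$ times
   $\mu^{-2}$. *)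
apply: le_trans (_ : (mu^-1 / 4) ^+ 2 * (8 * dW (b n) (b n)) <= _).
  by apply: ler_pM => //; rewrite ?sqr_ge0 ?(ip_ge0 hV).
have -> : (mu^-1 / 4) ^+ 2 * (8 * dW (b n) (b n)) =
  2^-1 * (mu^-1 ^+ 2 * dW (b n) (b n)) by field; rewrite gt_eqF.
have : 0 <= mu^-1 ^+ 2 * dW (b n) (b n) by rewrite mulr_ge0// sqr_ge0.
lra.
Qed.

(** The distance to [w] that an error-free relaxed step would reach. *)
Let s n w := `[(1 - lambda n) *: (v n - w) + lambda n *: (y n - w)]V.

(** The true iterate is the error-free one plus $\lambda_n$ times the error, and $\lambda_n\le1$. *)
Let vS_near n w : `| `[v n.+1 - w]V - s n w| <= e n.
Proof.
have /andP[l0 l1] := hlambda n.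
have {}l0 : 0 <= lambda n by apply: le_trans l0; exact: ltW.
set E := P (v n + tau n *: G (F (v n) + b n)) - y n + a n.
have -> : v n.+1 - w =
    ((1 - lambda n) *: (v n - w) + lambda n *: (y n - w)) + lambda n *: E.
  rewrite vS addrAC; set X := v n - w; set Y := y n - w.
  rewrite scalerBl scale1r -scalerN -!addrA -!scalerDr.
  congr (_ + (_ + _ *: _)); rewrite addrA /E /X /Y; set p := P _.
  rewrite opprB [y n - w]addrC [p - _ + _]addrAC (addrACA (- w)) subrr addr0.
  by rewrite addrACA subrr add0r addrC.
have eE : `[lambda n *: E]V <= e n.
  rewrite (ipnormZ hV) ger0_norm//; apply: le_trans (error_le n).
  by rewrite -[leRHS]mul1r ler_wpM2r// ipnorm_ge0.
set X := _ *: _ + _.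
have := ipnormD hV X (lambda n *: E); have := ipnormD_ge hV X (lambda n *: E).
rewrite /s -/X ler_norml; lra.
Qed.

(** Convexity of the squared norm carries the gain of [forward_backward_step] over to the relaxed
    step, scaled by $\lambda_n\ge\varepsilon$. *)
Let s_sqr_le n w : VI_solution w ->
  s n w ^+ 2 + eps * (dV ((v n - y n) + tau n *: G (F (v n) - F w))
                        ((v n - y n) + tau n *: G (F (v n) - F w))
  + 8 * eps ^+ 2 * dW (F (v n) - F w) (F (v n) - F w)) <= `[v n - w]V ^+ 2.
Proof.
move=> VIw; have /andP[l0 l1] := hlambda n.
have l0' : 0 <= lambda n by apply: le_trans l0; exact: ltW.
rewrite !(ipnorm_sqr hV).
have := @ip_sqr_convex _ _ _ hV (lambda n) (v n - w) (y n - w).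
rewrite l0' l1 => /(_ isT).
have := @forward_backward_step (tau n) (v n) w (y n) (tau_ge0 n) VIw erefl.
set q := dW _ _; set r := dV (v n - y n + _) _; set Y := dV (y n - w) _.
set A := dV (v n - w) _; set S := dV (_ + _) _ => H1 H2.
have q0 : 0 <= q := ip_ge0 hW _.
have r0 : 0 <= r := ip_ge0 hV _.
have /andP[t1 t2] := htau n.
(* Both $\tau_n$ and $\mu^{-1}/4-\tau_n$ are at least $\varepsilon$. *)
have H3 : eps * eps * q <= tau n * (mu^-1 / 4 - tau n) * q.
  by rewrite ler_wpM2r// ler_pM// ?(ltW eps_gt0)//; lra.
have H4 : eps * (r + 8 * eps ^+ 2 * q) <= lambda n * (r + 8 * eps ^+ 2 * q).
  rewrite ler_wpM2r//.
  have : 0 <= eps ^+ 2 * q by rewrite mulr_ge0 ?sqr_ge0.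
  lra.
have H5 : lambda n * (Y + r + 8 * eps ^+ 2 * q) <= lambda n * A.
  rewrite ler_wpM2l//; nra.
nra.
Qed.

Let s_le n w : VI_solution w -> s n w <= `[v n - w]V.
Proof.
move=> VIw; rewrite -(ler_pXn2r (n := 2)) ?nnegrE ?ipnorm_ge0//.
apply: le_trans (s_sqr_le n VIw); rewrite lerDl.
by rewrite mulr_ge0 ?addr_ge0 ?mulr_ge0 ?sqr_ge0 ?(ip_ge0 hV) ?(ip_ge0 hW)// ltW.
Qed.

Lemma fejer_cvg w : VI_solution w -> cvgn (fun n => `[v n - w]V).
Proof.
move=> VIw; apply: quasi_monotone_cvg e_summable => // n; first exact: ipnorm_ge0.
have := vS_near n w; rewrite ler_norml; have := s_le n VIw; lra.
Qed.

(** The error-free distances [s n w] are squeezed to the limit of $\|v_n-w\|$. The difference of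
    squares therefore vanishes, and it dominates both nonnegative gain terms. *)
Lemma residual_cvg w : VI_solution w ->
  (fun n => `[F (v n) - F w]W) @ \oo --> 0 /\ (fun n => `[v n - y n]V) @ \oo --> 0.
Proof.
move=> VIw; have /cvg_ex[/= l rl] := fejer_cvg VIw.
have e0 : e @ \oo --> 0 := cvg_series_cvg_0 e_summable.
have sl : s n w @[n --> \oo] --> l.
  apply: (@squeeze_cvgr _ _ _ _ (fun n => `[v n.+1 - w]V - e n)
    (fun n => `[v n - w]V)) => //.
    apply: nearW => n; rewrite s_le// andbT.
    have := vS_near n w; rewrite ler_norml; lra.
  rewrite -[l]subr0; apply: cvgB => //.
  by rewrite (cvg_shiftS (fun n => `[v n - w]V)).
have D0 : (fun n => `[v n - w]V ^+ 2 - s n w ^+ 2) @ \oo --> 0.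
  rewrite -(subrr (l ^+ 2)).
  by apply: cvgB; apply: (continuous_cvg _ (@exprn_continuous _ 2 l)).
set r := fun n => `[(v n - y n) + tau n *: G (F (v n) - F w)]V.
set q := fun n => `[F (v n) - F w]W.
have q2 n : 0 <= 8 * eps ^+ 2 * q n ^+ 2.
  exact: mulr_ge0 (mulr_ge0 (ler0n _ 8) (sqr_ge0 eps)) (sqr_ge0 (q n)).
have rq n : 0 <= r n ^+ 2 + 8 * eps ^+ 2 * q n ^+ 2 <=
    eps^-1 * (`[v n - w]V ^+ 2 - s n w ^+ 2).
  rewrite (addr_ge0 (sqr_ge0 _) (q2 n))/=.
  rewrite ler_pdivlMl// lerBrDl /r /q (ipnorm_sqr hV (_ + _)) (ipnorm_sqr hW).
  exact: s_sqr_le.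
have {}D0 : (fun n => eps^-1 * (`[v n - w]V ^+ 2 - s n w ^+ 2)) @ \oo --> 0.
  by rewrite -[X in _ --> X](mulr0 eps^-1); exact: cvgMr.
have q0 : q @ \oo --> 0.
  apply: sqr_cvg0 => [|?]; last exact: ipnorm_ge0.
  apply: (@squeeze0 _ _ (fun n => (8 * eps ^+ 2)^-1 *
     (eps^-1 * (`[v n - w]V ^+ 2 - s n w ^+ 2)))) => [k|]; last first.
    by rewrite -[X in _ --> X](mulr0 (8 * eps ^+ 2)^-1); exact: cvgMr.
  rewrite sqr_ge0/= ler_pdivlMl ?mulr_gt0 ?exprn_gt0//.
  by have := rq k; have := sqr_ge0 (r k); lra.
split=> //.
have r0 : r @ \oo --> 0.
  apply: sqr_cvg0 => [|n]; last exact: ipnorm_ge0.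
  apply: squeeze0 D0 => n; rewrite sqr_ge0/=.
  have := rq n; have := q2 n; lra.
(* Removes $\tau_nG(Fv_n-Fw)$ from [r], using $\tau_n\le\mu^{-1}$ and $|G|\le3$. *)
apply: (@squeeze0 _ _ (fun n => r n + (mu^-1 * 3) * q n)) => [k|]; last first.
  rewrite -[X in _ --> X]addr0; apply: cvgD => //.
  by rewrite -[X in _ --> X](mulr0 (mu^-1 * 3)); exact: cvgMr.
rewrite ipnorm_ge0/= -{1}(addrK (tau k *: G (F (v k) - F w)) (v k - y k)).
apply: le_trans (ipnormD hV _ _) _; rewrite lerD2l (ipnormN hV) (ipnormZ hV).
rewrite ger0_norm// -mulrA; apply: ler_pM; rewrite ?ipnorm_ge0 ?G_norm_le//.
have /andP[_] := htau k; have : 0 < mu^-1 by rewrite invr_gt0.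
move: eps_gt0; lra.
Qed.

(** * Cluster points and convergence of the iterates *)

Hypothesis compactV : forall (u : nat -> V) M, (forall n, `[u n]V <= M) ->
  exists ubar, exists2 phi : nat -> nat, phi @ \oo --> \oo &
    (fun n => `[u (phi n) - ubar]V) @ \oo --> 0.
Hypothesis C_closed : forall (u : nat -> V) ubar, (forall n, C (u n)) ->
  (fun n => `[u n - ubar]V) @ \oo --> 0 -> C ubar.

(** The residual vanishes, so the projected points [y (phi n)] tend to [vbar] too; the variational
    inequality of the projection, divided by the step, passes to the limit. *)
Lemma cluster_VI w vbar (phi : nat -> nat) : VI_solution w ->
  phi @ \oo --> \oo -> (fun n => `[v (phi n) - vbar]V) @ \oo --> 0 ->
  VI_solution vbar.
Proof.
move=> VIw phioo vphi; have [_ res0] := residual_cvg VIw.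
have C0 (f g : nat -> R) (c : R) : f @ \oo --> 0 -> g @ \oo --> 0 ->
    (fun n => f n + c * g n) @ \oo --> 0.
  move=> f0 g0; rewrite -[X in _ --> X]addr0; apply: cvgD => //.
  by rewrite -[X in _ --> X](mulr0 c); exact: cvgMr.
pose gam n := `[v (phi n) - y (phi n)]V.
have gam0 : gam @ \oo --> 0 := cvg_comp _ _ phioo res0.
pose al n := `[y (phi n) - vbar]V.
have al0 : al @ \oo --> 0.
  apply: squeeze0 (C0 _ _ 1 vphi gam0) => n.
  rewrite ipnorm_ge0/= mul1r addrC /gam (ipnormBC hV (v _)).
  exact: (ipnormB_trans hV).
pose be n := `[F (v (phi n)) - F vbar]W.
have be0 : be @ \oo --> 0.
  apply: squeeze0 (C0 _ _ (3 * mu) (cvg_cst 0) vphi) => n.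
  by rewrite ipnorm_ge0 add0r F_lipschitz.
have Cv : C vbar.
  by apply: (C_closed _ al0) => n; have [] := P_proj (v (phi n) + tau (phi n) *: G (F (v (phi n)))).
split=> // u Cu.
set A := `[u - vbar]V; set B := `[G (F vbar)]V.
(* The summands bound, in order, the projection inequality at [y (phi n)], the displacement of that
   point from [vbar], and the change of $G\circ F$. *)
pose rhs n := (eps^-1 * ((A + al n) * gam n)) + al n * (B + 3 * be n) + A * (3 * be n).
have rhs0 : rhs @ \oo --> 0.
  have -> : 0 = (eps^-1 * ((A + 0) * 0)) + 0 * (B + 3 * 0) + A * (3 * 0) by ring.
  apply: cvgD; first apply: cvgD.
  - by apply: cvgMr; apply: cvgM => //; apply: cvgD => //; exact: cvg_cst.
  - by apply: cvgM => //; apply: cvgD; [exact: cvg_cst|exact: cvgMr].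
  - by apply: cvgMr; exact: cvgMr.
have phi0 := cvgr_to_ge rhs0.
apply: phi0; apply: nearW => n.
pose m := phi n; have [Cy Py] := P_proj (v m + tau m *: G (F (v m))).
rewrite -/(y m) in Cy Py.
have E : dV (u - vbar) (G (F vbar)) = dV (u - y m) (G (F (v m))) +
    dV (y m - vbar) (G (F (v m))) + dV (u - vbar) (G (F vbar - F (v m))).
  by rewrite GB -(ipDl hV) subrKA (ipDr hV) (ipNr hV) [RHS]addrC subrK.
have ule : `[u - y m]V <= A + al n.
  by rewrite /al (ipnormBC hV (y _)); exact: (ipnormB_trans hV).
have Gle : `[G (F (v m))]V <= B + 3 * be n.
  rewrite -[G (F (v m))](subrK (G (F vbar))) -GB addrC.
  by apply: le_trans (ipnormD hV _ _) _; rewrite lerD2l G_norm_le.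
rewrite E /rhs; apply: lerD; first apply: lerD.
- have := Py _ Cu; rewrite addrAC (ipDr hV) (ipZr hV) => H.
  have /andP[t1 _] := htau m.
  rewrite ler_pdivlMl//.
  have H1 : - dV (u - y m) (v m - y m) <= (A + al n) * gam n.
    rewrite -(ipNr hV); apply: le_trans (ip_le_norm hV _ _) _.
    by rewrite (ipnormN hV) ler_wpM2r// ipnorm_ge0.
  have H2 : 0 <= (A + al n) * gam n by rewrite mulr_ge0 ?addr_ge0 ?ipnorm_ge0.
  (* The step may be replaced by its lower bound [eps] only when [X] is positive; otherwise the
     estimate is immediate. *)
  set X := dV _ (G _) in H *; case: (leP X 0) => X0.
    by apply: le_trans H2; rewrite mulr_ge0_le0// ltW.
  have : eps * X <= tau m * X by rewrite ler_wpM2r// ltW.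
  move: H H1; lra.
- apply: le_trans (ip_le_norm hV _ _) _.
  by rewrite ler_wpM2l ?ipnorm_ge0.
- apply: le_trans (ip_le_norm hV _ _) _.
  rewrite ler_wpM2l ?ipnorm_ge0//; apply: le_trans (G_norm_le _) _.
  by rewrite ler_wpM2l// (ipnormBC hW).
Qed.

(** The given solution yields boundedness, hence a cluster point [vbar], which is a solution. Then
    $\|v_n-\bar v\|$ itself converges, and its limit is 0 because it is so along a subsequence. *)
Theorem forward_backward_cvg w : VI_solution w ->
  exists vbar, [/\ VI_solution vbar,
    (fun n => `[v n - vbar]V) @ \oo --> 0 &
    (fun n => `[F (v n) - F vbar]W) @ \oo --> 0].
Proof.
move=> VIw.
have [M vM] : exists M, forall n, `[v n]V <= M.
  have /cvg_seq_bounded [M [_ Mv]] := fejer_cvg VIw.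
  exists (M + 1 + `[w]V) => n.
  have := Mv (M + 1); rewrite ltrDl ltr01 => /(_ isT n I) /=.
  rewrite ger0_norm ?ipnorm_ge0// => rM.
  by rewrite -{1}[v n](subrK w); apply: le_trans (ipnormD hV _ _) _; rewrite lerD2r.
have [vbar [phi phioo vphi]] := compactV vM.
have VIbar := cluster_VI VIw phioo vphi.
exists vbar; split=> //; last by have [] := residual_cvg VIbar.
have /cvg_ex[/= l rl] := fejer_cvg VIbar.
have l0 : (0 : R) = l.
  by apply: cvg_unique vphi (cvg_comp _ _ phioo rl); exact: Rhausdorff.
by rewrite l0.
Qed.

End ForwardBackward.

(** * Compactness and Frobenius norms *)

Section SequentialCompactness.
Context {R : realType}.

(** For each [k], an index at least [k] is chosen in the ball of radius $1/(k+1)$ about a cluster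
    point; [phi] tends to infinity but need not be monotone. *)
Lemma compact_subsequence {T : pseudoMetricType R} (K : set T) (u : nat -> T) :
  compact K -> (forall n, K (u n)) ->
  exists2 l, K l & exists2 phi : nat -> nat, phi @ \oo --> \oo &
    (fun n => u (phi n)) @ \oo --> l.
Proof.
move=> cK Ku; have [|l [Kl clu]] := cK (u @ \oo) _.
  by exists 0%N => // n _; exact: Ku.
exists l => //.
have /choice[phi phiP] : forall k, exists n, (k <= n)%N /\ ball l k.+1%:R^-1 (u n).
  move=> k; have k0 : 0 < k.+1%:R^-1 :> R by rewrite invr_gt0.
  have [|_ [[n kn <-] un]] := clu (u @` [set n | (k <= n)%N])
      (ball l k.+1%:R^-1) _ (nbhsx_ballx _ _ k0) => //.
    by exists k => // n /= kn; exists n.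
  by exists n.
exists phi.
  move=> A [k _ kA]; exists k => // n /= kn; apply: kA => /=.
  exact: leq_trans kn (phiP n).1.
apply/cvg_ballP => e e0; near=> n.
apply: le_ball (phiP n).2.
near: n; have := @cvg_harmonic R => /cvgr0Pnorm_le /(_ _ e0).
by apply: filterS => n; rewrite ger0_norm ?invr_ge0//=.
Unshelve. all: by end_near. Qed.

(** Without a minimizer, the sublevel sets through points of [K] generate a filter on [K]. Some
    value lies strictly below that at a cluster point, and semicontinuity separates its sublevel set
    from a neighbourhood of that point. *)
Lemma lsc_compact_min {T : topologicalType} (phi : T -> \bar R) (K : set T) :
  lower_semicontinuous phi -> compact K -> K !=set0 ->
  exists2 x, K x & forall y, K y -> (phi x <= phi y)%E.
Proof.
move=> lsc cK [y0 Ky0]; apply: contrapT => nomin.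
have lower x : K x -> exists2 y, K y & (phi y < phi x)%E.
  move=> Kx; apply: contrapT => nox; apply: nomin; exists x => // y Ky.
  by rewrite leNgt; apply/negP => yx; apply: nox; exists y.
pose S y := K `&` [set u | (phi u <= phi y)%E].
have FF : ProperFilter (filter_from K S).
  apply: filter_from_proper; last by move=> y Ky; exists y; split=> /=.
  apply: filter_from_filter; first by exists y0.
  move=> y y' Ky Ky'; have [yy'|/ltW yy'] := leP (phi y) (phi y').
    by exists y => // u [Ku uy]; split; split=> //=; exact: le_trans yy'.
  by exists y' => // u [Ku uy]; split; split=> //=; exact: le_trans yy'.
have [|x [Kx clx]] := cK _ FF; first by exists y0 => // u [].
(* The second descent places [phi y] strictly between two values, hence makes it finite. *)
have [y Ky yx] := lower x Kx; have [y' _ y'y] := lower y Ky.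
have yfin : phi y \is a fin_num.
  rewrite fin_numE; apply/andP; split.
    by apply/negP => /eqP yE; rewrite yE ltNge leNye in y'y.
  by apply/negP => /eqP yE; rewrite yE ltNge leey in yx.
have [V Vx HV] : exists2 V, nbhs x V & forall u, V u -> (phi y < phi u)%E.
  have [|V Vx HV] := lsc x (fine (phi y)); first by rewrite fineK.
  by exists V => // u /HV; rewrite fineK.
have [u [[_ /= uy] /HV]] : (S y) `&` V !=set0 by apply: clx => //; exists y.
by rewrite ltNge uy.
Qed.

(** A downward cone below the graph at each point gives lower semicontinuity. For the dual
    objective, subgradients supply the cones. *)
Lemma cone_minorant_compact_min {V : normedModType R} (G : V -> R) (K : set V) :
  (forall v, exists c, forall u, G v - c * `|v - u| <= G u) ->
  compact K -> K !=set0 -> exists2 v, K v & forall u, K u -> G v <= G u.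
Proof.
move=> minorant cK K0.
have lscG : lower_semicontinuous (EFin \o G).
  move=> v a; rewrite /= lte_fin => av.
  have [c cP] := minorant v.
  have c0 : 0 < `|c| + 1 by rewrite ltr_wpDl.
  have r0 : 0 < (G v - a) / (`|c| + 1) by rewrite divr_gt0// subr_gt0.
  exists (ball v ((G v - a) / (`|c| + 1))); first exact: nbhsx_ballx.
  move=> u; rewrite -ball_normE /= lte_fin ltr_pdivlMr// => uv.
  apply: lt_le_trans (cP u).
  have := normr_ge0 (v - u); have := ler_norm c; nra.
by have [v Kv vmin] := lsc_compact_min lscG cK K0; exists v.
Qed.

End SequentialCompactness.

Section Frobenius.
Context {R : realType} {N : nat}.
Implicit Types x y : 'M[R]_N.
Implicit Types v w : 'M[R]_N * 'M[R]_N.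

Lemma frob_dot_ip : inner_product (@frob_dot R N).
Proof.
split=> [x y|x y z|a x y|x].
- by apply: eq_bigr => k _; apply: eq_bigr => l _; rewrite mulrC.
- rewrite -big_split/=; apply: eq_bigr => k _; rewrite -big_split/=.
  by apply: eq_bigr => l _; rewrite mxE mulrDl.
- rewrite mulr_sumr; apply: eq_bigr => k _; rewrite mulr_sumr.
  by apply: eq_bigr => l _; rewrite mxE mulrA.
- by apply: sumr_ge0 => k _; apply: sumr_ge0 => l _; rewrite -expr2 sqr_ge0.
Qed.

Definition frob_dot2 v w : R := frob_dot v.1 w.1 + frob_dot v.2 w.2.

Lemma frob_dot2_ip : inner_product frob_dot2.
Proof.
have h := frob_dot_ip; split=> [v w|v w u|a v w|v].
- by rewrite /frob_dot2 !(ipC h v.1, ipC h v.2).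
- by rewrite /frob_dot2 !(ipDl h) addrACA.
- by rewrite /frob_dot2 !(ipZl h) mulrDr.
- by rewrite addr_ge0 ?(ip_ge0 h).
Qed.

Lemma frob_normE x : frob_norm x = ipnorm frob_dot x.
Proof.
rewrite /frob_norm /ipnorm; congr Num.sqrt.
by apply: eq_bigr => k _; apply: eq_bigr => l _; rewrite real_normK ?num_real.
Qed.

Lemma frob_norm2E v : frob_norm2 v = ipnorm frob_dot2 v.
Proof.
rewrite /frob_norm2 /ipnorm; congr Num.sqrt.
rewrite /frob_dot2 /frob_dot -big_split/=; apply: eq_bigr => k _; rewrite -big_split/=.
by apply: eq_bigr => l _; rewrite !real_normK ?num_real.
Qed.

Lemma mx_norm_le x (M : R) : 0 <= M -> (forall i j, `|x i j| <= M) -> `|x| <= M.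
Proof.
by move=> M0 xM; rewrite [leLHS]mx_normrE; apply/bigmax_leP; split.
Qed.

Lemma entry_le_mx_norm x i j : `|x i j| <= `|x|.
Proof.
rewrite [leRHS]mx_normrE; exact: (le_bigmax _ (fun ij => `|x ij.1 ij.2|) (i, j)).
Qed.

Lemma entry_sqr_le_frob x i j : x i j ^+ 2 <= frob_dot x x.
Proof.
have H k l : 0 <= x k l * x k l by rewrite -expr2 sqr_ge0.
rewrite /frob_dot (bigD1 i)//= (bigD1 j)//= expr2 -addrA lerDl addr_ge0//.
  by apply: sumr_ge0 => l _.
by apply: sumr_ge0 => k _; apply: sumr_ge0 => l _.
Qed.

Lemma mx_norm_le_frob x : `|x| <= ipnorm frob_dot x.
Proof.
apply: mx_norm_le => [|i j]; first exact: ipnorm_ge0.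
by rewrite -sqrtr_sqr ler_wsqrtr// entry_sqr_le_frob.
Qed.

Lemma frob_le_mx_norm x : ipnorm frob_dot x <= N%:R * `|x|.
Proof.
rewrite -(ler_pXn2r (n := 2)) ?nnegrE ?ipnorm_ge0 ?mulr_ge0//.
rewrite (ipnorm_sqr frob_dot_ip) exprMn.
apply: (@le_trans _ _ (\sum_(k < N) \sum_(l < N) `|x| ^+ 2)).
  apply: ler_sum => k _; apply: ler_sum => l _.
  rewrite -expr2 -(real_normK (num_real (x k l))) ler_pXn2r ?nnegrE//.
  exact: entry_le_mx_norm.
by rewrite !sumr_const !card_ord -mulrnA -(mulr_natl (`|x| ^+ 2)) natrM.
Qed.

Lemma frob_norm2_ge v : `|v| <= ipnorm frob_dot2 v.
Proof.
have h := frob_dot_ip.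
rewrite [leLHS]prod_normE ge_max; apply/andP; split.
  apply: le_trans (mx_norm_le_frob _) _.
  by rewrite ler_wsqrtr// lerDl (ip_ge0 h).
apply: le_trans (mx_norm_le_frob _) _.
by rewrite ler_wsqrtr// lerDr (ip_ge0 h).
Qed.

Lemma frob_norm2_le v : ipnorm frob_dot2 v <= ipnorm frob_dot v.1 + ipnorm frob_dot v.2.
Proof.
rewrite -(ler_pXn2r (n := 2)) ?nnegrE ?ipnorm_ge0 ?addr_ge0 ?ipnorm_ge0//.
rewrite (ipnorm_sqr frob_dot2_ip) sqrrD !(ipnorm_sqr frob_dot_ip).
rewrite addrAC lerDl mulrn_wge0// mulr_ge0 ?ipnorm_ge0//.
Qed.

Lemma frob_norm2_le_norm v : ipnorm frob_dot2 v <= (2 * N)%:R * `|v|.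
Proof.
apply: le_trans (frob_norm2_le v) _.
rewrite mul2n -addnn natrD mulrDl [`|v|]prod_normE.
apply: lerD; apply: le_trans (frob_le_mx_norm _) _; rewrite ler_wpM2l//.
  by rewrite le_max lexx.
by rewrite le_max lexx orbT.
Qed.

(** Transfers Frobenius estimates to the ambient topology. *)
Lemma frob_cvg (u : nat -> 'M[R]_N) (l : 'M[R]_N) :
  u @ \oo --> l <-> (fun n => ipnorm frob_dot (u n - l)) @ \oo --> 0.
Proof.
split=> [ul|ul0].
  apply: (@squeeze0 _ _ (fun n => N%:R * `|u n - l|)) => [n|].
    by rewrite ipnorm_ge0 frob_le_mx_norm.
  rewrite -[X in _ --> X](mulr0 N%:R); apply: cvgMr.
  by apply/norm_cvg0P; apply/subr_cvg0.
apply/subr_cvg0; apply/norm_cvg0P.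
by apply: squeeze0 ul0 => n; rewrite normr_ge0 mx_norm_le_frob.
Qed.

Lemma frob2_cvg (u : nat -> 'M[R]_N * 'M[R]_N) (l : 'M[R]_N * 'M[R]_N) :
  u @ \oo --> l <-> (fun n => ipnorm frob_dot2 (u n - l)) @ \oo --> 0.
Proof.
split=> [ul|ul0].
  apply: (@squeeze0 _ _ (fun n => (2 * N)%:R * `|u n - l|)) => [n|].
    by rewrite ipnorm_ge0 frob_norm2_le_norm.
  rewrite -[X in _ --> X](mulr0 (2 * N)%:R); apply: cvgMr.
  by apply/norm_cvg0P; apply/subr_cvg0.
apply/subr_cvg0; apply/norm_cvg0P.
by apply: squeeze0 ul0 => n; rewrite normr_ge0 frob_norm2_ge.
Qed.

(** Compactness of bounded closed sets is taken from row vectors and transported by [vec_mx], which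
    preserves the max norm. *)
Lemma mx_ball_compact (M : R) : compact [set x : 'M[R]_N | `|x| <= M].
Proof.
have [M0|M0] := ltP M 0.
  rewrite (_ : mkset _ = set0); first exact: compact0.
  apply/seteqP; split=> // x /= xM.
  by have := le_lt_trans (le_trans (normr_ge0 x) xM) M0; rewrite ltxx.
have -> : [set x : 'M[R]_N | `|x| <= M] =
    vec_mx @` [set v : 'rV[R]_(N * N) | `|v| <= M].
  apply/seteqP; split=> [x /= xM|_ /= [v vM <-]].
    exists (mxvec x); last exact: mxvecK.
    rewrite [leLHS]mx_normrE; apply/bigmax_leP; split=> // -[i j] _ /=.
    case/mxvec_indexP: j => k l; rewrite (ord1 i) mxvecE.
    exact: le_trans (entry_le_mx_norm _ _ _) xM.
  apply: mx_norm_le => // i j; rewrite mxE; apply: le_trans vM.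
  rewrite [leRHS]mx_normrE.
  exact: (le_bigmax _ (fun ij => `|v ij.1 ij.2|) (ord0, mxvec_index i j)).
apply: continuous_compact; last first.
  apply: bounded_closed_compact.
    by exists M; split; [exact: num_real|move=> y My v /= vM; exact: le_trans vM (ltW My)].
  have /continuous_closedP cl := @norm_continuous R 'rV[R]_(N * N).
  exact: cl _ (@closed_le R M).
apply: continuous_subspaceT => v.
apply/(@cvgrPdist_le _ _ _ (nbhs v)) => e e0.
have H : \forall w \near v, `|v - w| <= e.
  by apply: (@cvgr_dist_le _ _ _ (nbhs v) _ id v _ e e0); exact: cvg_id.
apply: filterS H => w vw.
rewrite -linearB/=; apply: mx_norm_le => [|i j]; first exact: ltW.
rewrite mxE; apply: le_trans vw; rewrite [leRHS]mx_normrE.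
exact: (le_bigmax _ (fun ij => `|(v - w) ij.1 ij.2|) (ord0, mxvec_index i j)).
Qed.

Lemma frob2_bounded_subsequence (u : nat -> 'M[R]_N * 'M[R]_N) M :
  (forall n, ipnorm frob_dot2 (u n) <= M) ->
  exists ubar, exists2 phi : nat -> nat, phi @ \oo --> \oo &
    (fun n => ipnorm frob_dot2 (u (phi n) - ubar)) @ \oo --> 0.
Proof.
move=> uM.
have [|l _ [phi phioo ul]] := compact_subsequence
    (compact_setX (@mx_ball_compact M) (@mx_ball_compact M)) (u := u).
  move=> n; have := le_trans (frob_norm2_ge (u n)) (uM n).
  by rewrite prod_normE ge_max => /andP[].
by exists l, phi => //; apply/frob2_cvg.
Qed.

End Frobenius.

(** * Unit balls of the plane *)

Section LpPlane.
Context {R : realType}.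
Implicit Types (p : \bar R) (u y : R * R) (r s : R).
Local Notation "p ^*" := (hoelder_conjugate p).

Definition dot2 u y : R := u.1 * y.1 + u.2 * y.2.

Lemma conj_exponentP p : (1 <= p)%E ->
  [\/ p = 1%E /\ p^* = +oo%E, p = +oo%E /\ p^* = 1%E |
      exists r s, [/\ p = r%:E, p^* = s%:E, 1 < r, 1 < s & r^-1 + s^-1 = 1]].
Proof.
case: p => [r| |//]; last by constructor 2.
rewrite le_eqVlt => /predU1P[<-|r1].
  by constructor 1; rewrite hoelder_conjugate1.
rewrite lte_fin in r1; have r0 : r - 1 != 0 by rewrite subr_eq0 gt_eqF.
have r_gt0 : 0 < r by apply: lt_trans r1.
constructor 3; exists r, (r / (r - 1)); split=> //.
- by rewrite /hoelder_conjugate/= gt_eqF// inver subr_eq0 gt_eqF// EFinM.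
- by rewrite ltr_pdivlMr ?subr_gt0// mul1r gtrBl.
- by rewrite invf_div -{1}[r^-1]mul1r -mulrDl addrC subrK divff ?gt_eqF.
Qed.

Lemma lp_norm1 u : lp_norm 1%E u = `|u.1| + `|u.2|.
Proof. by rewrite /lp_norm/= !powRr1// invr1 powRr1// addr_ge0. Qed.

Lemma lp_norm0 p : (1 <= p)%E -> lp_norm p (0, 0) = 0.
Proof.
case: p => [r| |//] /=; last by rewrite normr0 maxxx.
rewrite lee_fin => r1; have r0 : r != 0 by rewrite gt_eqF// (lt_le_trans _ r1).
by rewrite normr0 powR0// addr0 powR0// invr_neq0.
Qed.

Lemma lp_norm_ge_coord p u : (1 <= p)%E -> `|u.1| <= lp_norm p u /\ `|u.2| <= lp_norm p u.
Proof.
case: p => [r| |//] /=; last by rewrite !le_max !lexx orbT.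
rewrite lee_fin => r1; have r0 : 0 < r by rewrite (lt_le_trans _ r1).
have H x : 0 <= x -> x = (x `^ r) `^ r^-1.
  by move=> x0; rewrite -powRrM divff ?gt_eqF// powRr1.
have rV : 0 <= r^-1 by rewrite invr_ge0 ltW.
by split; rewrite {1}[`|_|]H// ge0_ler_powR// ?nnegrE ?addr_ge0 ?powR_ge0//
  ?lerDl ?lerDr powR_ge0.
Qed.

Lemma dot2_le_norm u y : dot2 u y <= `|u.1| * `|y.1| + `|u.2| * `|y.2|.
Proof. by rewrite -!normrM lerD// ler_norm. Qed.

Lemma lp_holder p u y : (1 <= p)%E -> dot2 u y <= lp_norm (p^*) u * lp_norm p y.
Proof.
move=> p1; apply: le_trans (dot2_le_norm _ _) _.
have [[-> ->]|[-> ->]|[r [s [-> -> r1 s1 rs]]]] := conj_exponentP p1.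
- by rewrite lp_norm1 mulrDr/= lerD// ler_wpM2r// le_max lexx ?orbT.
- by rewrite lp_norm1 mulrDl/= lerD// ler_wpM2l// le_max lexx ?orbT.
- by apply: hoelder2 => //; rewrite ?(lt_trans lte01)// ?(lt_trans ltr01)// addrC.
Qed.

(** The equality case of Hölder: signs for $p=1$, a signed unit vector at a largest coordinate for
    $p=\infty$, and signed powers $|t|^{r-1}$, normalized, in between. *)
Lemma lp_dual_attained p y : (1 <= p)%E ->
  exists2 u, lp_ball (p^*) u & dot2 u y = lp_norm p y.
Proof.
have sg_le1 (x : R) : `|Num.sg x| <= 1 by rewrite normr_sg; case: (x != 0).
move=> p1; rewrite /lp_ball /dot2.
have [[-> ->]|[-> ->]|[r [s [-> -> r1 s1 rs]]]] := conj_exponentP p1.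
- exists (Num.sg y.1, Num.sg y.2); last by rewrite lp_norm1 /= -!normrEsg.
  by rewrite /= ge_max !sg_le1.
- have [y12|y12] := leP `|y.1| `|y.2|.
    exists (0, Num.sg y.2); first by rewrite /mkset lp_norm1/= normr0 add0r.
    by rewrite /= mul0r add0r -normrEsg max_r.
  exists (Num.sg y.1, 0); first by rewrite /mkset lp_norm1/= normr0 addr0.
  by rewrite /= mul0r addr0 -normrEsg max_l// ltW.
have r_gt0 : 0 < r by apply: lt_trans r1.
have s_gt0 : 0 < s by apply: lt_trans s1.
have srE : (r - 1) * s = r.
  have -> : s = (1 - r^-1)^-1 by rewrite -rs addrAC subrr add0r invrK.
  by field; rewrite gt_eqF//= gt_eqF// subr_gt0.
set S := `|y.1| `^ r + `|y.2| `^ r.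
have S0 : 0 <= S by rewrite addr_ge0 ?powR_ge0.
(* A vanishing [S] cannot be normalized; then the norm of [y] is 0 and $u=0$ works. *)
have [Sz|SN0] := eqVneq S 0.
  exists (0, 0); first by rewrite /mkset lp_norm0 ?ler01 ?lee_fin ?ltW.
  by rewrite /= !mul0r addr0 -/S Sz powR0// invr_neq0 ?gt_eqF.
(* As $(r-1)s=r$, this factor gives the witness $\ell^s$ norm 1. *)
set c := S `^ (- s^-1); have c0 : 0 <= c := powR_ge0 _ _.
have cs : c `^ s = S^-1.
  by rewrite /c -powRrM mulNr mulVf ?gt_eqF// powR_inv1.
pose g (t : R) := Num.sg t * (`|t| `^ (r - 1) * c).
have gs t : `|g t| `^ s = `|t| `^ r / S.
  rewrite /g; have [->|t0] := eqVneq t 0.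
    by rewrite sgr0 mul0r !normr0 !powR0 ?gt_eqF// mul0r.
  rewrite normrM normr_sg t0 mul1r ger0_norm ?mulr_ge0 ?powR_ge0//.
  by rewrite powRM ?powR_ge0// -powRrM srE cs.
have gt t : g t * t = `|t| `^ r * c.
  rewrite /g mulrAC -normrEsg mulrA; congr (_ * _).
  rewrite -[X in X * _](@powRr1 _ `|t|)// -powRD; first by rewrite addrC subrK.
  by rewrite addrC subrK gt_eqF.
exists (g y.1, g y.2).
  by rewrite /= !gs -mulrDl divff// powR1.
rewrite /= !gt -mulrDl -/S /c -[X in X * _]powRr1// -powRD.
  by congr (_ `^ _); rewrite -rs addrK.
by rewrite SN0 implybT.
Qed.

(** The ball becomes an intersection of half-planes, so its convexity and closedness reduce to facts
    about linear forms. *)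
Lemma lp_ball_polar p u : (1 <= p)%E ->
  lp_ball p u <-> forall y, lp_ball (p^*) y -> dot2 u y <= 1.
Proof.
move=> p1; split=> [up y yq|H].
  have := lp_holder y u p1; rewrite /dot2 ![y.1 * _]mulrC ![y.2 * _]mulrC => /le_trans; apply.
  have q1 := hoelder_conj_ge1 p1.
  rewrite -[leRHS](mulr1 1) ler_pM//.
    by apply: le_trans (lp_norm_ge_coord y q1).1.
  by apply: le_trans (lp_norm_ge_coord u p1).1.
rewrite /lp_ball /mkset; have [y yq <-] := lp_dual_attained u p1.
by have := H _ yq; rewrite /dot2 ![y.1 * _]mulrC ![y.2 * _]mulrC.
Qed.

Lemma lp_ball_convex p u u' (t : R) : (1 <= p)%E -> 0 <= t <= 1 ->
  lp_ball p u -> lp_ball p u' ->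
  lp_ball p (u.1 + t * (u'.1 - u.1), u.2 + t * (u'.2 - u.2)).
Proof.
move=> p1 /andP[t0 t1] /(lp_ball_polar _ p1) Hu /(lp_ball_polar _ p1) Hu'.
apply/(lp_ball_polar _ p1) => y yq; have := Hu _ yq; have := Hu' _ yq.
rewrite /dot2 /=; nra.
Qed.

Lemma lp_ball_closed p : (1 <= p)%E -> closed (lp_ball p : set (R * R)).
Proof.
move=> p1.
have -> : lp_ball p =
    \bigcap_(y in lp_ball (p^*)) [set u : R * R | dot2 u y <= 1].
  by apply/seteqP; split=> u /= /(lp_ball_polar u p1).
apply: closed_bigI => y _.
have : continuous (fun u : R * R => dot2 u y).
  move=> u; rewrite /dot2; apply: cvgD; apply: cvgMl.
    exact: cvg_fst.
  exact: cvg_snd.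
by move=> /continuous_closedP H; exact: H _ (@closed_le R 1).
Qed.

Lemma lp_ball_compact p : (1 <= p)%E -> compact (lp_ball p : set (R * R)).
Proof.
move=> p1; apply: subclosed_compact (lp_ball_closed p1)
  (compact_setX (@segment_compact _ (-1) 1) (@segment_compact _ (-1) 1)) _.
move=> u /= up; have [u1 u2] := lp_norm_ge_coord u p1.
by split; rewrite /= in_itv/= -ler_norml; exact: le_trans up.
Qed.

Lemma eucl_norm_le_sqr u y : eucl_norm u <= eucl_norm y ->
  u.1 ^+ 2 + u.2 ^+ 2 <= y.1 ^+ 2 + y.2 ^+ 2.
Proof.
rewrite /eucl_norm !real_normK ?num_real// ler_sqrt//.
by rewrite addr_ge0 ?sqr_ge0.
Qed.

(** Existence of a nearest point, which guarantees that [get] does not return its default value. *)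
Lemma lp_proj_minimizer p y : (1 <= p)%E ->
  minimizer (lp_ball p) (fun u => eucl_norm (y - u)) (lp_proj p y).
Proof.
move=> p1; apply: (@getPex _ (minimizer (lp_ball p) (fun u => eucl_norm (y - u)))).
have [||c cp Hc] := @compact_EVT_min _ _ (fun u : R * R => eucl_norm (y - u))
    (lp_ball p) _ (lp_ball_compact p1).
- by exists (0, 0); rewrite /lp_ball /mkset lp_norm0 ?ler01.
- apply: continuous_subspaceT => u.
  apply: (@continuous_comp _ _ _ (fun u : R * R =>
    `|(y - u).1| ^+ 2 + `|(y - u).2| ^+ 2) Num.sqrt); last exact: sqrt_continuous.
  apply: cvgD; rewrite /= !expr2; apply: cvgM; apply: cvg_norm.
  + by apply: cvgB; [exact: cvg_cst|exact: cvg_fst].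
  + by apply: cvgB; [exact: cvg_cst|exact: cvg_fst].
  + by apply: cvgB; [exact: cvg_cst|exact: cvg_snd].
  + by apply: cvgB; [exact: cvg_cst|exact: cvg_snd].
exists c; split; first by rewrite inE in cp.
by move=> u up; apply: Hc; rewrite inE.
Qed.

(** The first-order condition: compare the projection with points of the segment towards [u] and let
    $t\to0$. *)
Lemma lp_projP p y : (1 <= p)%E -> lp_ball p (lp_proj p y) /\
  forall u, lp_ball p u ->
    (u.1 - (lp_proj p y).1) * (y.1 - (lp_proj p y).1) +
    (u.2 - (lp_proj p y).2) * (y.2 - (lp_proj p y).2) <= 0.
Proof.
move=> p1; have [] := lp_proj_minimizer y p1.
move: (lp_proj p y) => P Pp Pmin; split=> // u up.
set d1 := u.1 - P.1; set d2 := u.2 - P.2.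
apply: (@le0_of_small _ _ (d1 ^+ 2 + d2 ^+ 2)) => t /andP[t0 t1].
have t01 : 0 <= t <= 1 by rewrite !ltW.
have := eucl_norm_le_sqr (Pmin _ (lp_ball_convex p1 t01 Pp up)).
rewrite /= -/d1 -/d2 => H.
rewrite -(ler_pM2l t0); nra.
Qed.

End LpPlane.

(** * Proximity operators and the Moreau envelope of the conjugate *)

Section Prox.
Context {R : realType} {N : nat}.
Implicit Types (w x y : 'M[R]_N).
Local Notation "''[' x , y ]" := (frob_dot x y) (format "''[' x ,  y ]").
Let h := @frob_dot_ip R N.

Lemma frob_norm_sqr x : frob_norm x ^+ 2 = '[x, x].
Proof. by rewrite frob_normE (ipnorm_sqr h). Qed.

Lemma frob_sqr_continuous w : continuous (fun y => 2^-1 * frob_norm (w - y) ^+ 2).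
Proof.
have -> : (fun y => 2^-1 * frob_norm (w - y) ^+ 2) =
    (fun y => 2^-1 * \sum_k \sum_l (w k l - y k l) * (w k l - y k l)).
  apply/funext => y; rewrite frob_norm_sqr; congr (_ * _).
  by apply: eq_bigr => k _; apply: eq_bigr => l _; rewrite !mxE.
suff C : continuous (fun y => \sum_k \sum_l (w k l - y k l) * (w k l - y k l)).
  move=> y; exact: (@cvgM _ _ (nbhs y) _ _ _ _ _ (cvg_cst _) (C y)).
apply: (@continuous_big R _ +%R 0 xpredT) => [|k _]; first exact: add_continuous.
apply: (@continuous_big R _ +%R 0 xpredT) => [|l _ y]; first exact: add_continuous.
have H : (fun y : 'M[R]_N => w k l - y k l) @ y --> w k l - y k l.
  exact: (@cvgB _ _ _ (nbhs y) _ _ _ _ _ (cvg_cst _) (@coord_continuous _ _ _ k l y)).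
exact: (@cvgM _ _ (nbhs y) _ _ _ _ _ H H).
Qed.

Lemma lsc_add_continuous {T : topologicalType} (f : T -> \bar R) (g : T -> R) :
  (forall x : T, (-oo < f x)%E) -> lower_semicontinuous f -> continuous g ->
  lower_semicontinuous (fun x : T => (f x + (g x)%:E)%E).
Proof.
move=> fNy lsc gc x a ax.
(* The level [a] is split into $b<f(x)$ and $a-b<g(x)$; the case $f(x)=+\infty$ needs its own
   [b]. *)
have [b bf ab] : exists2 b : R, (b%:E < f x)%E & a - b < g x.
  move: (fNy x) ax; case: (f x) => [r| |]// _.
    rewrite lte_fin => ar; exists ((r + (a - g x)) / 2); last by lra.
    by rewrite lte_fin; lra.
  by move=> _; exists (a - g x + 1); [rewrite ltry|lra].
have [V Vx HV] := lsc x b bf.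
have gV : nbhs x [set y | a - b < g y].
  by apply: (@cvgr_gt _ _ (nbhs x) _ g (g x)) => //; exact: gc.
exists (V `&` [set y | a - b < g y]); first exact: filterI.
move=> y [/HV by_ /=]; rewrite ltrBlDr addrC => agy.
apply: (@lt_trans _ _ (b%:E + (g y)%:E)%E); first by rewrite -EFinD lte_fin.
by rewrite lteD2rE.
Qed.

Context {f : 'M[R]_N -> \bar R}.
Hypotheses (f_proper : proper_fun f) (f_lsc : lower_semicontinuous f)
  (f_convex : convex_efun f).

Let fNy x : (-oo < f x)%E := f_proper.1 x.

(* The minimum m of f over a ball propagates outwards along the segments from
   x0 by convexity, with slope at least m - f x0. *)
Lemma convex_lsc_lower_bound x0 : (f x0 < +oo)%E ->
  exists m c : R, [/\ 0 <= c & forall y, ((m - c * `|y - x0|)%:E <= f y)%E].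
Proof.
move=> fx0.
have fx0fin : f x0 \is a fin_num by rewrite fin_numElt fNy.
have [||xm xmB Hm] := @lsc_compact_min _ _ f [set x | `|x| <= `|x0| + 1] f_lsc.
- exact: mx_ball_compact.
- by exists x0; rewrite /= lerDl.
have x0B : `|x0| <= `|x0| + 1 by rewrite lerDl.
have fxm : f xm \is a fin_num.
  by rewrite fin_numElt fNy (le_lt_trans (Hm _ x0B)).
have mx0 : fine (f xm) <= fine (f x0) by rewrite -lee_fin !fineK// Hm.
exists (fine (f xm)), (fine (f x0) - fine (f xm)); rewrite subr_ge0; split=> // y.
have [->|fy] := eqVneq (f y) +oo%E; first by rewrite leey.
have fyfin : f y \is a fin_num by rewrite fin_numElt fNy ltey.
rewrite -(fineK fyfin) lee_fin.
move: (fine (f xm)) (fine (f x0)) (fineK fxm) (fineK fx0fin) mx0 => m a mE aE ma.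
have [d1|d1] := leP `|y - x0| 1.
  have : m <= fine (f y).
    rewrite -lee_fin mE fineK// Hm//=.
    by rewrite -[y](subrK x0) addrC; apply: le_trans (ler_normD _ _) _; rewrite lerD2l.
  have : 0 <= (a - m) * `|y - x0| by rewrite mulr_ge0// subr_ge0.
  lra.
set d := `|y - x0| in d1 *.
have d0 : 0 < d by apply: lt_trans d1.
have t01 : 0 < d^-1 < 1 by rewrite invr_gt0 d0 invf_lt1.
(* The point [s] of the segment lies at distance 1 from [x0], inside the ball where [m] is the
   minimum. *)
have := f_convex y x0 t01; set s := _ + _ => fs.
have sB : `|s| <= `|x0| + 1.
  have -> : s = x0 + d^-1 *: (y - x0).
    by rewrite /s scalerBl scale1r scalerBr addrCA.
  apply: le_trans (ler_normD _ _) _; rewrite lerD2l normrZ.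
  by rewrite gtr0_norm ?invr_gt0// mulVf// gt_eqF.
have := le_trans (Hm _ sB) fs.
rewrite -mE -aE -(fineK fyfin) -!EFinM -EFinD lee_fin.
rewrite -(ler_pM2l d0) mulrDr !mulrA divff ?gt_eqF// mulrBr mulr1 divff ?gt_eqF//.
lra.
Qed.

(** Existence by coercivity: outside a large ball the quadratic term beats the linear lower bound on
    [f]. *)
Lemma prox_minimizer w : minimizer setT (prox_objective f w) (prox f w).
Proof.
apply: (@getPex _ (minimizer setT (prox_objective f w))).
have [x0 fx0] := f_proper.2.
have fx0fin : f x0 \is a fin_num by rewrite fin_numElt fNy.
have [m [c [c0 lb]]] := convex_lsc_lower_bound fx0.
pose A := fine (f x0) + 2^-1 * frob_norm (w - x0) ^+ 2.
pose B := A - m + c * `|w| + c * `|x0|.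
(* For $|y|>M$ and $s=|y|-|w|$, this radius gives $s(s/2-c)\ge1+|B|$, which puts the objective at
   [y] above its value [A] at [x0]. *)
pose M := `|w| + `|x0| + 2 * c + 2 * `|B| + 2.
have lscP : lower_semicontinuous (prox_objective f w).
  by apply: lsc_add_continuous => //; exact: frob_sqr_continuous.
have x0M : `|x0| <= M by rewrite /M; have := normr_ge0 w; have := normr_ge0 B; lra.
have [||xm _ Hm] := @lsc_compact_min _ _ _ [set x : 'M[R]_N | `|x| <= M] lscP.
- exact: mx_ball_compact.
- by exists x0.
exists xm; split=> // y _.
have [yM|yM] := leP `|y| M; first exact: Hm.
apply: (le_trans (Hm _ x0M)).
have -> : prox_objective f w x0 = A%:E by rewrite /prox_objective EFinD fineK.
apply: (@le_trans _ _ ((m - c * `|y - x0|)%:E + (2^-1 * frob_norm (w - y) ^+ 2)%:E)%E); last first.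
  by rewrite /prox_objective leeD2r.
rewrite -EFinD lee_fin frob_normE.
have H1 : `|y| - `|w| <= `|w - y|.
  by rewrite distrC; exact: lerB_dist.
have H2 := mx_norm_le_frob (w - y).
have H3 : `|y - x0| <= `|y| + `|x0| by exact: ler_normB.
set s := `|y| - `|w| in H1.
have s_ge : 2 * c + 2 * `|B| + 2 <= s.
  by rewrite /s; move: yM; rewrite /M; have := normr_ge0 x0; lra.
have H4 : c * `|y - x0| <= c * (s + `|w| + `|x0|).
  by rewrite ler_wpM2l// /s; lra.
have B0 := normr_ge0 B; have BB := ler_norm B.
have s0 : 0 <= s by lra.
have H5 : s ^+ 2 <= ipnorm frob_dot (w - y) ^+ 2.
  by rewrite ler_pXn2r ?nnegrE ?ipnorm_ge0//; exact: le_trans H2.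
have H6 : `|B| <= s * (2^-1 * s - c).
  have : 1 * (1 + `|B|) <= s * (2^-1 * s - c) by apply: ler_pM => //; lra.
  lra.
rewrite /B in BB H6 *; nra.
Qed.

Lemma prox_fin_num w : f (prox f w) \is a fin_num.
Proof.
have [x0 fx0] := f_proper.2; have [_ /(_ x0 I)] := prox_minimizer w.
rewrite /prox_objective => H; rewrite fin_numElt fNy/=.
rewrite ltNge leye_eq; apply/negP => /eqP E; move: H; rewrite E addye//.
rewrite leye_eq => /eqP; have : f x0 \is a fin_num by rewrite fin_numElt fNy.
by move=> /fineK <-.
Qed.

(** The residual $w-\operatorname{prox}_fw$ is a subgradient at the proximal point: test minimality
    at $ty+(1-t)p$ and let $t\to0$. *)
Lemma prox_subgradient w y :
  (f (prox f w) + '[y - prox f w, w - prox f w]%:E <= f y)%E.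
Proof.
have pfin := prox_fin_num w; have [_ pmin] := prox_minimizer w.
move: (prox f w) pfin pmin => p pfin pmin.
have [->|fy] := eqVneq (f y) +oo%E; first by rewrite leey.
have fyfin : f y \is a fin_num by rewrite fin_numElt fNy ltey.
rewrite -(fineK fyfin) -(fineK pfin) -EFinD lee_fin -subr_le0.
apply: (@le0_of_small _ _ (2^-1 * '[y - p, y - p])) => t t01.
have := pmin (t *: y + (1 - t) *: p) I; rewrite /prox_objective.
have := f_convex y p t01; set s := _ + _ => fs ps.
have {}ps := le_trans ps (leeD2r _ fs).
move: ps; rewrite -(fineK fyfin) -(fineK pfin) -!EFinM -!EFinD lee_fin.
have -> : w - s = (w - p) - t *: (y - p).
  by rewrite /s scalerBl scale1r addrCA -scalerBr opprD addrA.
rewrite !frob_norm_sqr (ip_sqrB h (w - p)) !(ipZr h) (ipZl h) (ipC h (w - p) (y - p)).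
move: t01 => /andP[t0 t1] H; rewrite -(ler_pM2l t0); nra.
Qed.

(** The sum of two subgradient inequalities, each tested at the other proximal point. *)
Lemma prox_firm w w' :
  '[prox f w - prox f w', prox f w - prox f w'] <= '[prox f w - prox f w', w - w'].
Proof.
have := prox_subgradient w (prox f w'); have := prox_subgradient w' (prox f w).
have := prox_fin_num w; have := prox_fin_num w'.
move: (prox f w) (prox f w') => p p' pfin' pfin.
rewrite -(fineK pfin) -(fineK pfin'); move: (fine _) (fine _) => a b.
rewrite -!EFinD !lee_fin => H1 H2.
have -> : w - w' = (w - p) - (w' - p') + (p - p').
  by rewrite opprB addrAC !subrKA.
rewrite [leRHS](ipDr h) lerDr (ipDr h) (ipNr h).
rewrite -(opprB p p') (ipNl h) in H2.
move: H1 H2; set X := '[_, w - p]; set Y := '[_, _]; lra.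
Qed.

(** Equals $\frac12\|w\|^2$ minus the Moreau envelope of [f] at [w]. *)
Definition env_conj w : R :=
  '[prox f w, w] - 2^-1 * '[prox f w, prox f w] - fine (f (prox f w)).

(* Moreau decomposition: the infimum is attained at w - prox f w. *)
Lemma moreau_env_fenchel_conj w : moreau_env (fenchel_conj f) w = (env_conj w)%:E.
Proof.
rewrite /env_conj; have pfin := prox_fin_num w; have psub := prox_subgradient w.
move: (prox f w) pfin psub => p pfin psub.
have conj_ge u : (('[p, u] - fine (f p))%:E <= fenchel_conj f u)%E.
  by apply: ereal_sup_ubound; exists p => //; rewrite EFinB fineK.
apply/eqP; rewrite eq_le; apply/andP; split.
  apply: (@le_trans _ _ (prox_objective (fenchel_conj f) w (w - p))).
    by apply: ereal_inf_lbound; exists (w - p).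
  apply: (@le_trans _ _ (('[p, w - p] - fine (f p))%:E + (2^-1 * '[p, p])%:E)%E).
    have -> : prox_objective (fenchel_conj f) w (w - p) =
        (fenchel_conj f (w - p) + (2^-1 * '[p, p])%:E)%E.
      by rewrite /prox_objective frob_norm_sqr opprB addrCA subrr addr0.
    rewrite leeD2r//.
    apply: ge_ereal_sup => _ [y _ <-].
    have [->|fy] := eqVneq (f y) +oo%E; first by rewrite addeC/= leNye.
    have fyfin : f y \is a fin_num by rewrite fin_numElt fNy ltey.
    have := psub y; rewrite -(fineK fyfin) -(fineK pfin) -!EFinD -?EFinB !lee_fin.
    by rewrite (ipDl h y) (ipNl h); lra.
  by rewrite -EFinD lee_fin (ipDr h) (ipNr h); lra.
apply: le_ereal_inf_tmp => _ [u _ <-]; rewrite /prox_objective.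
apply: le_trans (leeD2r _ (conj_ge u)).
rewrite -EFinD lee_fin frob_norm_sqr.
(* The objective at [u] exceeds the claimed value by at least $\frac12\|w-u-p\|^2$. *)
have := ip_ge0 h (w - u - p); rewrite (ip_sqrB h (w - u)).
rewrite (ipC h (w - u)) (ipDr h p) (ipNr h); lra.
Qed.

(** Stands in for differentiability of the envelope. It follows from the subgradient inequality of
    [f] at [prox f w'], with $\frac12\|p-p'\|^2$ to spare. *)
Lemma env_conj_subgradient w w' :
  env_conj w + '[prox f w, w' - w] <= env_conj w'.
Proof.
rewrite /env_conj; have := prox_subgradient w' (prox f w).
rewrite -(fineK (prox_fin_num w)) -(fineK (prox_fin_num w')) -EFinD lee_fin.
move: (prox f w) (prox f w') => p p'; set a := fine _; set b := fine _.
have := ip_ge0 h (p - p'); rewrite (ip_sqrB h).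
rewrite !(ipDl h, ipDr h, ipNl h, ipNr h)/=; lra.
Qed.

End Prox.

(** * Discrete gradient and divergence *)

Section DiscreteGradient.
Context {R : realType}.

Lemma sum_by_parts n (a xi : 'I_n -> R) :
  \sum_(k < n) ((if (k.+1 < n)%N then a k else 0) -
                (if k == 0%N :> nat then 0 else a (ord_pred k))) * xi k =
  - \sum_(k < n) a k * (if (k.+1 < n)%N then xi (ordS k) - xi k else 0).
Proof.
under eq_bigr do rewrite mulrBl.
(* The cyclic shift is harmless: its wrap-around lands on index 0, where the coefficient is 0. *)
rewrite sumrB (reindex_inj (P := xpredT) (F := fun k : 'I_n =>
  (if k == 0%N :> nat then 0 else a (ord_pred k)) * xi k) (@ordS_inj n)).
rewrite -sumrB -sumrN; apply: eq_bigr => k _.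
rewrite ordSK /=; have kn' := ltn_ord k; case: (ltnP k.+1 n) => kn.
  by rewrite modn_small//=; ring.
have -> : k.+1 = n by apply/eqP; rewrite eqn_leq kn andbT.
by rewrite modnn/=; ring.
Qed.

(** From $(a-b)^2\le2a^2+2b^2$ and invariance of the sum under the cyclic shift. The two directions
    together yield the constant 8. *)
Lemma sum_sqr_diff_le n (xi : 'I_n -> R) :
  \sum_(k < n) (if (k.+1 < n)%N then xi (ordS k) - xi k else 0) ^+ 2 <=
  4 * \sum_(k < n) xi k ^+ 2.
Proof.
apply: (@le_trans _ _ (\sum_(k < n) (2 * xi (ordS k) ^+ 2 + 2 * xi k ^+ 2))).
  apply: ler_sum => k _; case: ifP => _; last first.
    by rewrite expr0n/= addr_ge0// mulr_ge0// sqr_ge0.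
  have := sqr_ge0 (xi (ordS k) + xi k); nra.
rewrite big_split/= -!mulr_sumr.
rewrite -(reindex_inj (P := xpredT) (F := fun k => xi k ^+ 2) (@ordS_inj n)); lra.
Qed.

Context {N : nat}.
Implicit Types (x : 'M[R]_N) (v : 'M[R]_N * 'M[R]_N).

(** All boundary cases, including $N=1$, in the shape required by [sum_by_parts]. *)
Lemma div1E (eta : 'M[R]_N) k l : div1 eta k l =
  (if (k.+1 < N)%N then eta k l else 0) -
  (if k == 0%N :> nat then 0 else eta (ord_pred k) l).
Proof.
rewrite /div1; have [N1|N1] := eqVneq N 1%N.
  have -> : nat_of_ord k = 0%N.
    by have := ltn_ord k; move: (nat_of_ord k) => m; rewrite N1; case: m.
  by rewrite [X in if X then _ else _](_ : _ = false) ?subrr// N1.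
have kN := ltn_ord k.
have [->|k0] := eqVneq (nat_of_ord k) 0%N.
  by rewrite ifT ?subr0// ltn_neqAle eq_sym N1 (leq_ltn_trans _ kN).
by case: ifP => _; rewrite ?sub0r.
Qed.

Lemma div2E (eta : 'M[R]_N) k l : div2 eta k l =
  (if (l.+1 < N)%N then eta k l else 0) -
  (if l == 0%N :> nat then 0 else eta k (ord_pred l)).
Proof.
rewrite /div2; have [N1|N1] := eqVneq N 1%N.
  have -> : nat_of_ord l = 0%N.
    by have := ltn_ord l; move: (nat_of_ord l) => m; rewrite N1; case: m.
  by rewrite [X in if X then _ else _](_ : _ = false) ?subrr// N1.
have lN := ltn_ord l.
have [->|l0] := eqVneq (nat_of_ord l) 0%N.
  by rewrite ifT ?subr0// ltn_neqAle eq_sym N1 (leq_ltn_trans _ lN).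
by case: ifP => _; rewrite ?sub0r.
Qed.

Lemma div_adjoint v x : frob_dot (div v) x = - frob_dot2 v (grad x).
Proof.
rewrite /frob_dot2 opprD /frob_dot.
transitivity (\sum_k \sum_l div1 v.1 k l * x k l + \sum_k \sum_l div2 v.2 k l * x k l).
  rewrite -big_split/=; apply: eq_bigr => k _; rewrite -big_split/=.
  by apply: eq_bigr => l _; rewrite mxE mulrDl.
congr (_ + _).
  rewrite exchange_big [in RHS]exchange_big -sumrN/=; apply: eq_bigr => l _.
  under eq_bigr do rewrite div1E.
  rewrite (sum_by_parts (fun k => v.1 k l) (fun k => x k l)); congr (- _).
  by apply: eq_bigr => k _; rewrite mxE.
rewrite -sumrN; apply: eq_bigr => k _.
under eq_bigr do rewrite div2E.
rewrite (sum_by_parts (fun l => v.2 k l) (fun l => x k l)); congr (- _).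
by apply: eq_bigr => l _; rewrite mxE.
Qed.

Lemma grad_bound x : frob_dot2 (grad x) (grad x) <= 8 * frob_dot x x.
Proof.
have -> : 8 * frob_dot x x = 4 * frob_dot x x + 4 * frob_dot x x by ring.
rewrite /frob_dot2 /frob_dot; apply: lerD.
  rewrite exchange_big/= [in leRHS]exchange_big/= mulr_sumr.
  apply: ler_sum => l _; apply: le_trans (sum_sqr_diff_le (fun k => x k l)).
  by apply: ler_sum => k _; rewrite mxE.
rewrite mulr_sumr.
apply: ler_sum => k _; apply: le_trans (sum_sqr_diff_le (fun l => x k l)).
by apply: ler_sum => l _; rewrite mxE.
Qed.

Lemma gradB x y : grad (x - y) = grad x - grad y.
Proof.
by congr pair; apply/matrixP => k l; rewrite !mxE; case: ifP => _; rewrite ?subr0//; ring.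
Qed.

Lemma divB v w : div (v - w) = div v - div w.
Proof.
apply/matrixP => k l; rewrite !mxE !div1E !div2E !mxE.
by do ![case: ifP => _]; ring.
Qed.

End DiscreteGradient.

(** * Duality *)

Section DualBall.
Context {R : realType} {N : nat}.
Implicit Types (v u y : 'M[R]_N * 'M[R]_N) (x : 'M[R]_N) (p : \bar R).
Local Notation "p ^*" := (hoelder_conjugate p).

Lemma dual_ballP p v :
  dual_ball p v <-> forall k l, lp_ball (p^*) (v.1 k l, v.2 k l).
Proof.
split=> [vp k l|vp].
  move/bigmax_leP : vp => [_ /(_ k isT)] /bigmax_leP[_ /(_ l isT)].
  exact.
apply/bigmax_leP; split=> // k _; apply/bigmax_leP; split=> // l _.
exact: vp.
Qed.

Lemma dual_ball_convex p u v (t : R) : (1 <= p)%E -> 0 <= t <= 1 ->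
  dual_ball p u -> dual_ball p v -> dual_ball p (u + t *: (v - u)).
Proof.
move=> p1 t01 /dual_ballP up /dual_ballP vp; apply/dual_ballP => k l.
rewrite !mxE.
exact: (lp_ball_convex (hoelder_conj_ge1 p1) t01 (up k l) (vp k l)).
Qed.

Lemma dual_ball_closed p : (1 <= p)%E ->
  closed (dual_ball p : set ('M[R]_N * 'M[R]_N)).
Proof.
move=> p1.
have -> : (dual_ball p : set ('M[R]_N * 'M[R]_N)) =
    \bigcap_(kl in [set: 'I_N * 'I_N])
      (fun v => (v.1 kl.1 kl.2, v.2 kl.1 kl.2)) @^-1` lp_ball (p^*).
  apply/seteqP; split=> v; first by move/dual_ballP => vp kl _; exact: vp.
  by move=> vp; apply/dual_ballP => k l; exact: (vp (k, l)).
apply: closed_bigI => -[k l] _ /=.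
have : continuous (fun v : 'M[R]_N * 'M[R]_N => (v.1 k l, v.2 k l)).
  move=> v.
  have c1 : (fun v : 'M[R]_N * 'M[R]_N => v.1 k l) @ v --> v.1 k l.
    exact: (@continuous_comp _ _ _ fst (fun M : 'M[R]_N => M k l) v cvg_fst
      (@coord_continuous _ _ _ k l _)).
  have c2 : (fun v : 'M[R]_N * 'M[R]_N => v.2 k l) @ v --> v.2 k l.
    exact: (@continuous_comp _ _ _ snd (fun M : 'M[R]_N => M k l) v cvg_snd
      (@coord_continuous _ _ _ k l _)).
  exact: (cvg_pair c1 c2).
move=> /continuous_closedP H.
exact: H _ (lp_ball_closed (hoelder_conj_ge1 p1)).
Qed.

Lemma dual_ball_compact p : (1 <= p)%E ->
  compact (dual_ball p : set ('M[R]_N * 'M[R]_N)).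
Proof.
move=> p1; apply: subclosed_compact (dual_ball_closed p1)
  (compact_setX (@mx_ball_compact R N 1) (@mx_ball_compact R N 1)) _.
move=> v /dual_ballP vp; have q1 := hoelder_conj_ge1 p1.
split; apply: mx_norm_le => // k l; have := lp_norm_ge_coord (v.1 k l, v.2 k l) q1.
  by move=> [H _]; exact: le_trans H (vp k l).
by move=> [_ H]; exact: le_trans H (vp k l).
Qed.

Definition dual_proj p y : 'M[R]_N * 'M[R]_N :=
  (\matrix_(k, l) (pi_ p (y.1 k l, y.2 k l)).1,
   \matrix_(k, l) (pi_ p (y.1 k l, y.2 k l)).2).

(** Both the constraint and the inner product split over pixels, so the projection is computed
    pixelwise. *)
Lemma dual_projP p y : (1 <= p)%E -> dual_ball p (dual_proj p y) /\
  forall u, dual_ball p u ->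
    frob_dot2 (u - dual_proj p y) (y - dual_proj p y) <= 0.
Proof.
move=> p1; have q1 := hoelder_conj_ge1 p1; split.
  apply/dual_ballP => k l; rewrite !mxE -surjective_pairing.
  exact: (lp_projP _ q1).1.
move=> u /dual_ballP up; rewrite /frob_dot2 /frob_dot -big_split/=.
apply: sumr_le0 => k _; rewrite -big_split/=; apply: sumr_le0 => l _.
rewrite !mxE; exact: ((lp_projP (y.1 k l, y.2 k l) q1).2 _ (up k l)).
Qed.

(** With [tv_dual_attained], this makes $\operatorname{tv}_p$ the support function of $D_p$ at the
    gradient. *)
Lemma dual_ball_le_tv p v x : (1 <= p)%E -> dual_ball p v ->
  frob_dot2 v (grad x) <= tv p x.
Proof.
move=> p1 /dual_ballP vp; rewrite /frob_dot2 /frob_dot /tv -big_split/=.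
apply: ler_sum => k _; rewrite -big_split/=; apply: ler_sum => l _.
set g := ((grad x).1 k l, (grad x).2 k l).
apply: (le_trans (lp_holder (v.1 k l, v.2 k l) g p1)).
rewrite ler_piMl//; last exact: vp.
by apply: le_trans (lp_norm_ge_coord g p1).1.
Qed.

Lemma tv_dual_attained p x : (1 <= p)%E ->
  exists2 u, dual_ball p u & frob_dot2 u (grad x) = tv p x.
Proof.
move=> p1.
have H (kl : 'I_N * 'I_N) : exists g, lp_ball (p^*) g /\
    dot2 g ((grad x).1 kl.1 kl.2, (grad x).2 kl.1 kl.2) =
    lp_norm p ((grad x).1 kl.1 kl.2, (grad x).2 kl.1 kl.2).
  by have [g gp gE] := lp_dual_attained
    ((grad x).1 kl.1 kl.2, (grad x).2 kl.1 kl.2) p1; exists g.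
have [g gP] := choice H.
exists (\matrix_(k, l) (g (k, l)).1, \matrix_(k, l) (g (k, l)).2).
  apply/dual_ballP => k l; rewrite !mxE -surjective_pairing.
  exact: (gP (k, l)).1.
rewrite /frob_dot2 /frob_dot /tv -big_split/=.
apply: eq_bigr => k _; rewrite -big_split/=; apply: eq_bigr => l _.
by have [_ <-] := gP (k, l); rewrite /dot2 !mxE.
Qed.

End DualBall.

Section Duality.
Context {R : realType} {N : nat} {f : 'M[R]_N -> \bar R} {z : 'M[R]_N} {mu : R} {p : \bar R}.
Hypotheses (f_proper : proper_fun f) (f_lsc : lower_semicontinuous f)
  (f_convex : convex_efun f) (mu_gt0 : 0 < mu) (p1 : (1 <= p)%E).
Implicit Types (v u : 'M[R]_N * 'M[R]_N) (x y : 'M[R]_N).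
Let h := @frob_dot_ip R N.
Let h2 := @frob_dot2_ip R N.

Local Notation F v := (prox f (z + mu *: div v)).
Local Notation dual_VI :=
  (@VI_solution R _ _ frob_dot2 grad div mu z (prox f) (dual_ball p)).

Let T_firm := prox_firm f_proper f_lsc f_convex.

Lemma env_conj_dual_le v u :
  env_conj (f := f) (z + mu *: div v) - mu * frob_dot2 (u - v) (grad (F v)) <=
  env_conj (f := f) (z + mu *: div u).
Proof.
apply: le_trans (env_conj_subgradient f_proper f_lsc f_convex (z + mu *: div v) (z + mu *: div u)).
rewrite lerD2l opprD addrACA subrr add0r -scalerBr -divB (ipZr h) (ipC h).
by rewrite div_adjoint mulrN.
Qed.

(** A minimizer over the compact dual ball exists by the cone criterion; minimality is then turned
    into the variational inequality by [VI_of_segment]. *)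
Lemma dual_VI_exists : exists v, dual_VI v.
Proof.
have minorant v : exists c, forall u, env_conj (f := f) (z + mu *: div v) - c * `|v - u| <=
    env_conj (f := f) (z + mu *: div u).
  exists (mu * (ipnorm frob_dot2 (grad (F v)) * (2 * N)%:R)) => u.
  apply: le_trans (env_conj_dual_le v u).
  rewrite lerD2l lerN2 -mulrA ler_pM2l//.
  apply: le_trans (ip_le_norm h2 _ _) _.
  rewrite mulrC -mulrA ler_wpM2l ?ipnorm_ge0// distrC.
  exact: frob_norm2_le_norm.
have [|v vp vmin] := cone_minorant_compact_min minorant (@dual_ball_compact R N p p1).
  have [u up _] := tv_dual_attained (0 : 'M[R]_N) p1.
  by exists u.
exists v; split=> // u up.
apply: (VI_of_segment h2 h (@gradB R N) (@divB R N) (@div_adjoint R N)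
  (@grad_bound R N) mu_gt0 T_firm) => t t01.
have /andP[t0 t1] := t01; have t01' : 0 <= t <= 1 by rewrite !ltW.
have vtp := dual_ball_convex p1 t01' vp up.
have vtE : v - (v + t *: (u - v)) = - t *: (u - v).
  by rewrite opprD addrA subrr add0r scaleNr.
move: (v + t *: (u - v)) vtp vtE => vt vtp vtE.
(* The subgradient is taken at [vt], not at [v]: combined with minimality of [v], it fixes the sign
   of the inner product there. *)
have := le_trans (env_conj_dual_le vt v) (vmin _ vtp); rewrite gerDl oppr_le0.
by rewrite vtE (ipZl h2) mulNr mulrN oppr_ge0 pmulr_rle0// pmulr_rle0.
Qed.

Lemma dual_VI_minimizer v : dual_VI v ->
  minimizer (dual_ball p) (dual_objective f mu z) v.
Proof.
move=> [vp VIv]; split; first exact: vp.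
move=> u up; rewrite /dual_objective !(moreau_env_fenchel_conj f_proper f_lsc f_convex) lee_fin.
apply: le_trans (env_conj_dual_le v u).
by rewrite lerDl oppr_ge0 pmulr_rle0// VIv.
Qed.

Lemma dual_VI_tv v : dual_VI v -> frob_dot2 v (grad (F v)) = tv p (F v).
Proof.
move=> [vp VIv]; apply/eqP; rewrite eq_le dual_ball_le_tv//=.
have [u up <-] := tv_dual_attained (F v) p1.
by have := VIv _ up; rewrite (ipDl h2) (ipNl h2) subr_le0.
Qed.

(** The proximal subgradient inequality, with [div] moved onto [grad]: the dual term equals [tv] at
    [F v] and is at most [tv] at [y]. Expanding the square leaves the surplus that gives
    uniqueness. *)
Lemma primal_strongly_minimal v y : dual_VI v ->
  (primal_objective f mu p z (F v) + (2^-1 * frob_dot (y - F v) (y - F v))%:E <=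
   primal_objective f mu p z y)%E.
Proof.
move=> VIv; have tvE := dual_VI_tv VIv; have [vp _] := VIv.
have := prox_subgradient f_proper f_lsc f_convex (z + mu *: div v) y.
have := prox_fin_num f_proper f_lsc f_convex (z + mu *: div v).
move: (F v) tvE => x tvE xfin; rewrite /primal_objective.
have [->|fy] := eqVneq (f y) +oo%E; first by move=> _; rewrite !addye// leey.
have fyfin : f y \is a fin_num by rewrite fin_numElt f_proper.1 ltey.
rewrite -(fineK fyfin) -(fineK xfin) -!EFinD !lee_fin !frob_norm_sqr.
have -> : z + mu *: div v - x = (z - x) + mu *: div v by rewrite addrAC.
rewrite (ipDr h) (ipZr h) (ipC h _ (div v)) div_adjoint gradB.
rewrite (ipDr h2) (ipNr h2) tvE.
have -> : y - z = (y - x) + (x - z) by rewrite subrKA.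
rewrite (ip_sqrD h (y - x) (x - z)) -[z - x]opprB (ipNr h).
have : mu * frob_dot2 v (grad y) <= mu * tv p y.
  by rewrite ler_pM2l// dual_ball_le_tv.
lra.
Qed.

Lemma primal_minimizer v : dual_VI v ->
  minimizer setT (primal_objective f mu p z) (F v).
Proof.
move=> VIv; split=> // y _; apply: le_trans (primal_strongly_minimal y VIv).
by rewrite leeDl// lee_fin mulr_ge0// (ip_ge0 h).
Qed.

Lemma primal_minimizer_unique v y : dual_VI v ->
  minimizer setT (primal_objective f mu p z) y -> y = F v.
Proof.
move=> VIv [_ /(_ (F v) I)] /(le_trans (primal_strongly_minimal y VIv)).
have xfin := prox_fin_num f_proper f_lsc f_convex (z + mu *: div v).
rewrite /primal_objective -(fineK xfin) -!EFinD lee_fin gerDl => H.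
have n0 : ipnorm frob_dot (y - F v) = 0.
  apply/eqP; rewrite -sqrf_eq0 (ipnorm_sqr h) eq_le (ip_ge0 h) andbT.
  by move: H; rewrite pmulr_rle0// invr_gt0.
apply/eqP; rewrite -subr_eq0 -normr_le0.
by have := mx_norm_le_frob (y - F v); rewrite n0.
Qed.

End Duality.

(** * Summability of the errors and convergence of the algorithm *)

Lemma cvg_series_of_lty {R : realType} (u : R^nat) : (forall n, 0 <= u n) ->
  (\sum_(0 <= n <oo) (u n)%:E < +oo)%E -> cvgn (series u).
Proof.
move=> u0 H; apply: nondecreasing_is_cvgn; first by apply: nondecreasing_series.
have u0E n : (0 <= n)%N -> true -> (0 <= (u n)%:E)%E by rewrite lee_fin.
have fin : (\sum_(0 <= n <oo) (u n)%:E)%E \is a fin_num.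
  by rewrite ge0_fin_numE// nneseries_ge0.
exists (fine (\sum_(0 <= n <oo) (u n)%:E)%E) => _ [n _ <-].
rewrite -lee_fin fineK// /series/= -sumEFin.
exact: nneseries_lim_ge.
Qed.

Unset Implicit Arguments.

Theorem proposition4p17 (R : realType) (N : nat) (hN : (1 <= N)%N)
    (z : 'M[R]_N) (f : 'M[R]_N -> \bar R)
    (f_proper : proper_fun f) (f_lsc : lower_semicontinuous f)
    (f_convex : convex_efun f)
    (mu : R) (hmu : 0 < mu)
    (p : \bar R) (hp : (1 <= p)%E)
    (alpha1 alpha2 : nat -> 'M[R]_N)
    (halpha : (\sum_(0 <= n <oo) (frob_norm2 (alpha1 n, alpha2 n))%:E < +oo)%E)
    (b : nat -> 'M[R]_N)
    (hb : (\sum_(0 <= n <oo) (frob_norm (b n))%:E < +oo)%E)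
    (eps : R) (heps : 0 < eps < Num.min 1 (mu^-1 / 8))
    (v0 : 'M[R]_N * 'M[R]_N)
    (tau : nat -> R) (htau : forall n, eps <= tau n <= mu^-1 / 4 - eps)
    (lambda : nat -> R) (hlambda : forall n, eps <= lambda n <= 1)
    (x : nat -> 'M[R]_N) (zeta v : nat -> 'M[R]_N * 'M[R]_N)
    (hv0 : v 0%N = v0)
    (hx : forall n, x n = prox f (z + mu *: div (v n)) + b n)
    (hzeta : forall n, zeta n = v n + tau n *: grad (x n))
    (hv1 : forall n (k l : 'I_N),
      (v n.+1).1 k l = (v n).1 k l + lambda n *
        ((pi_ p ((zeta n).1 k l, (zeta n).2 k l)).1
         + alpha1 n k l - (v n).1 k l))
    (hv2 : forall n (k l : 'I_N),
      (v n.+1).2 k l = (v n).2 k l + lambda n *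
        ((pi_ p ((zeta n).1 k l, (zeta n).2 k l)).2
         + alpha2 n k l - (v n).2 k l)) :
  exists vsol : 'M[R]_N * 'M[R]_N,
    [/\ v @ \oo --> vsol,
        minimizer (dual_ball p) (dual_objective f mu z) vsol,
        minimizer setT (primal_objective f mu p z)
          (prox f (z + mu *: div vsol)),
        (forall y, minimizer setT (primal_objective f mu p z) y ->
           y = prox f (z + mu *: div vsol))
      & x @ \oo --> prox f (z + mu *: div vsol)].
Proof.
have h := @frob_dot_ip R N; have h2 := @frob_dot2_ip R N.
have T_firm := prox_firm f_proper f_lsc f_convex.
have [w VIw] := dual_VI_exists (z := z) f_proper f_lsc f_convex hmu hp.
have eps0 : 0 < eps by have /andP[] := heps.
have bs : cvgn (series (fun n => ipnorm frob_dot (b n))).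
  apply: cvg_series_of_lty => [n|]; first exact: ipnorm_ge0.
  by under eq_eseriesr do rewrite -frob_normE.
have als : cvgn (series (fun n => ipnorm frob_dot2 (alpha1 n, alpha2 n))).
  apply: cvg_series_of_lty => [n|]; first exact: ipnorm_ge0.
  by under eq_eseriesr do rewrite -frob_norm2E.
(* The entrywise updates are assembled into the abstract iteration with [dual_proj]. *)
have vS n : v n.+1 = v n + lambda n *:
    (dual_proj p (v n + tau n *: grad (prox f (z + mu *: div (v n)) + b n))
     + (alpha1 n, alpha2 n) - v n).
  rewrite -hx -hzeta [LHS]surjective_pairing.
  by congr pair; apply/matrixP => k l; rewrite !mxE ?hv1 ?hv2.
have Cclosed (u : nat -> 'M[R]_N * 'M[R]_N) ubar : (forall n, dual_ball p (u n)) ->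
    (fun n => ipnorm frob_dot2 (u n - ubar)) @ \oo --> 0 -> dual_ball p ubar.
  move=> uC /frob2_cvg; apply: closed_cvg (dual_ball_closed hp) _ _.
  exact: nearW.
have [vsol [VIsol vcvg Fcvg]] := @forward_backward_cvg _ _ _ _ _ h2 h _ _
  (@gradB R N) (@divB R N) (@div_adjoint R N) (@grad_bound R N) mu z (prox f)
  (dual_ball p) (dual_proj p) hmu T_firm (fun y => dual_projP y hp) eps tau lambda
  (fun n => (alpha1 n, alpha2 n)) b v eps0 htau hlambda als bs vS
  (@frob2_bounded_subsequence R N) Cclosed w VIw.
exists vsol; split.
- exact/frob2_cvg.
- exact: dual_VI_minimizer.
- exact: primal_minimizer.
- by move=> y; exact: primal_minimizer_unique.
(* The proximal points converge by the previous theorem, and $b_n\to0$ as the term of a convergent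
   series. *)
have -> : x = (fun n => prox f (z + mu *: div (v n)) + b n).
  by apply/funext => n; exact: hx.
rewrite -[X in _ --> X]addr0; apply: cvgD; first exact/frob_cvg.
apply/frob_cvg; under eq_fun do rewrite subr0.
exact: cvg_series_cvg_0 bs.
Qed.
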